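(* Let $n\ge 1$ and let $\{P_1,\dots,P_r\}$ be a collection of indecomposable deformed $n$-permutahedra that are pairwise fertile, i.e. such that the pair $(P_i,P_j)$ is fertile for all $i\in[r]$ and $j\in[r]$. For $1\le i,j\le r$ let $R_{i,j}\subset\mathbb{R}^{n+1}$ denote the polytope $$R_{i,j} := \;\uparrow\!\Bigl(\bigl(P_j+\phi_{P_i,P_j}(\lambda_{i,j},1)\bigr)\boxdot\bigl(\lambda_{i,j}P_i\bigr)\Bigr),\qquad \lambda_{i,j}:=\min\{\lambda\;;\;(\lambda,1)\in\Lambda(P_i,P_j)\}.$$ Then $\{R_{i,j} : 1\le i,j\le r\}$ is a collection of indecomposable deformed $(n+1)$-permutahedra which are also pairwise fertile (i.e. $(R_{i,j},R_{k,\ell})$ is fertile for all $i,j,k,\ell\in[r]$).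
   Context: A deformed $n$-permutahedron is a polytope $P\subset\mathbb{R}^n$ all of whose edges are parallel to vectors $e_i-e_j$ with $i,j\in[n]$. A polytope $P$ is indecomposable if $P=Q+R$ (Minkowski sum) implies that $Q$ and $R$ are translated dilates of $P$. The submodular cone $\mathbb{SC}_n$ is the cone (under Minkowski sum and dilation) of all deformed $n$-permutahedra; its rays (modulo translations) correspond to the indecomposable deformed $n$-permutahedra that are not points. Throughout, the indecomposable deformed permutahedra $P_i$ are assumed not to be points. For $\sigma\in\mathcal{S}_n$ let $C_\sigma=\{c\in\mathbb{R}^n : c_{\sigma(1)}\le c_{\sigma(2)}\le\dots\le c_{\sigma(n)}\}$. For a deformed $n$-permutahedron $P$, $P^\sigma$ denotes the vertex of $P$ maximizing $\langle\cdot,c\rangle$ over $P$ for any (equivalently every) $c$ in the interior of $C_\sigma$, and $P^\sigma_i$ is its $i$-th coordinate. For indecomposable deformed $n$-permutahedra $P,Q$ (not points), define $\phi_{P,Q}:\mathbb{R}^2\to\mathbb{R}^n$ by $\phi_{P,Q}(\lambda,\mu)_i=\min_{\sigma\in\mathcal{S}_n}(\lambda P^\sigma_i-\mu Q^\sigma_i)$. A couple $(\lambda,\mu)$ with $\lambda,\mu>0$ is a seed for $(P,Q)$ if there exist an index $j\in[n]$ and two permutations $\tau,\tau'$ in the set of minimizers of $\sigma\mapsto\lambda P^\sigma_j-\mu Q^\sigma_j$ over $\mathcal{S}_n$ such that $(P^\tau_j,Q^\tau_j)\ne(P^{\tau'}_j,Q^{\tau'}_j)$. The seed-set $\Lambda(P,Q)$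 is the set of all seeds of $(P,Q)$, and the ordered pair $(P,Q)$ is fertile if $\Lambda(P,Q)\neq\emptyset$. For polytopes $P,Q\subset\mathbb{R}^n$, the GP-sum is $Q\boxdot P:=(Q+\mathbb{R}^n_{+})\cap(P+\mathbb{R}^n_{-})$, with $\mathbb{R}_+=[0,\infty)$, $\mathbb{R}_-=(-\infty,0]$. For a polytope $S\subset\mathbb{R}^n$, its lift is $\uparrow\! S:=\{(x,-\sum_{i=1}^n x_i) : x\in S\}\subset\mathbb{R}^{n+1}$. *)

(* Defs.v *)
From HB Require Import structures.
From mathcomp Require Import all_boot all_order all_algebra all_fingroup.
From mathcomp Require Import all_classical all_reals all_analysis.

Set Implicit Arguments.
Unset Strict Implicit.
Unset Printing Implicit Defensive.

Import Order.TTheory GRing.Theory Num.Theory.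
Import numFieldNormedType.Exports.

Local Open Scope classical_set_scope.
Local Open Scope ring_scope.

Section Polytopes.
Variables (R : realType) (n : nat).
Implicit Types (P Q X : set 'rV[R]_n) (x c : 'rV[R]_n).

Definition dotp x c : R := \sum_i x ord0 i * c ord0 i.

Definition conv_hull X : set 'rV[R]_n :=
  smallest (@convex_set R 'rV[R]_n) X.

(* Polytopes are nonempty, so that their vertices [P^sigma] exist. *)
Definition polytope P :=
  exists X, [/\ finite_set X, X !=set0 & P = conv_hull X].

Definition mink_sum P Q : set 'rV[R]_n := [set x + y | x in P & y in Q].

Definition translate P t : set 'rV[R]_n := [set x + t | x in P].

Definition dilate (a : R) P : set 'rV[R]_n := [set a *: x | x in P].

Definition max_face P c : set 'rV[R]_n :=
  [set x : 'rV[R]_n | P x /\ forall y, P y -> dotp y c <= dotp x c].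

(* The edges of [P] are its one-dimensional faces, i.e. the nondegenerate
   segments [[u, v]] among its faces. *)
Definition is_edge P (u v : 'rV[R]_n) :=
  u != v /\ exists c, max_face P c = conv_hull [set u; v].

Definition e_ (i : 'I_n) : 'rV[R]_n := delta_mx ord0 i.

Definition deformed_permutahedron P :=
  polytope P /\
  forall u v, is_edge P u v -> exists i j a, v - u = a *: (e_ i - e_ j).

(* The dilation factor may be [0]: a point is a translated dilate of [P]. *)
Definition translated_dilate P Q :=
  exists a t, 0 <= a /\ Q = translate (dilate a P) t.

Definition indecomposable P :=
  forall Q S, polytope Q -> polytope S -> P = mink_sum Q S ->
    translated_dilate P Q /\ translated_dilate P S.

Definition is_point P := exists x, P = [set x].

Definition indec_deformed_permutahedron P :=
  [/\ deformed_permutahedron P, indecomposable P & ~ is_point P].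

Definition braid_cone (s : 'S_n) : set 'rV[R]_n :=
  [set c : 'rV[R]_n |
    forall i j : 'I_n, (i <= j)%N -> c ord0 (s i) <= c ord0 (s j)].

(* [P^sigma].  A point maximizing every [c] of a nonempty open set is unique;
   it exists whenever [P] is a deformed permutahedron (the value is [0] if
   there is none). *)
Definition vert P (s : 'S_n) : 'rV[R]_n :=
  xget 0 [set v : 'rV[R]_n | forall c, (braid_cone s)° c -> max_face P c v].

Definition vert_diff P Q (lam mu : R) (i : 'I_n) (s : 'S_n) : R :=
  lam * vert P s ord0 i - mu * vert Q s ord0 i.

Definition phi P Q (lam mu : R) : 'rV[R]_n :=
  \row_i \big[Num.min/vert_diff P Q lam mu i 1%g]_(s : 'S_n)
            vert_diff P Q lam mu i s.

Definition minimizers (f : 'S_n -> R) : set 'S_n :=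
  [set s | forall s', f s <= f s'].

Definition is_seed P Q (lam mu : R) :=
  [/\ 0 < lam, 0 < mu &
    exists j t t',
      [/\ minimizers (vert_diff P Q lam mu j) t,
          minimizers (vert_diff P Q lam mu j) t' &
          (vert P t ord0 j, vert Q t ord0 j)
            <> (vert P t' ord0 j, vert Q t' ord0 j)]].

Definition seed_set P Q : set (R * R) := [set lm | is_seed P Q lm.1 lm.2].

Definition fertile P Q := seed_set P Q !=set0.

Definition nonneg_orthant : set 'rV[R]_n :=
  [set x : 'rV[R]_n | forall i, 0 <= x ord0 i].
Definition nonpos_orthant : set 'rV[R]_n :=
  [set x : 'rV[R]_n | forall i, x ord0 i <= 0].

(* [gp_sum Q P] is [Q \boxdot P]; the order of the arguments matters. *)
Definition gp_sum Q P : set 'rV[R]_n :=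
  mink_sum Q nonneg_orthant `&` mink_sum P nonpos_orthant.

Definition lift_point x : 'rV[R]_(n + 1) :=
  row_mx x (const_mx (- \sum_i x ord0 i)).

Definition lift_set P : set 'rV[R]_(n + 1) := lift_point @` P.

(* The least element of [A] ([0] if there is none). *)
Definition least (A : set R) : R := xget 0 (A `&` lbound A).

Definition min_seed P Q : R := least [set lam | seed_set P Q (lam, 1)].

(* [R_{i,j}] is [offspring P_i P_j]: the dilated polytope [P_i] is the second
   argument of the GP-sum. *)
Definition offspring P Q : set 'rV[R]_(n + 1) :=
  let lam := min_seed P Q in
  lift_set (gp_sum (translate Q (phi P Q lam 1)) (dilate lam P)).

End Polytopes.

(* Main.v *)
Require Import Defs.
From HB Require Import structures.
From mathcomp Require Import all_boot all_order all_algebra all_fingroup.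
From mathcomp Require Import all_classical all_reals all_analysis.
From mathcomp Require Import ring lra zify.

(** The proof replaces polytopes by their vertices.  A deformed permutahedron
is the convex hull of its vertices [P^sigma], and a family [v] of points
indexed by permutations arises in this way exactly when it is [coherent]:
among the points of the family, [v s] maximizes every direction of the closed
braid cone of [s] ([deformed_coherent], [coherent_deformed], [vert_hull]).
Minkowski sums become pointwise sums, and indecomposability becomes rigidity:
if [v] is the sum of two coherent families, then each of them has the form
[a *: v + u] ([indecomposable_rigid], [rigid_indecomposable]).

Let [lam] be the minimal seed of [(P, Q)], and let [p] and [q] be the vertex
families of [lam P] and [Q + phi].  By the choice of [phi], [q] lies below [p]
coordinatewise, and in each coordinate some permutation gives an equality.
Being a seed means that some coordinate [j] has two equalities with distinct
values.  An order of [n + 1] elements is an order [s] of the [n] old ones with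
a fresh element inserted.  The vertex of the offspring for this order takes
its [i]-th coordinate from [p s] if [i] is above the fresh element and from
[q s] if it is below; the last coordinate makes the sum zero ([glue]).
Indeed, once a direction is normalized to vanish on the fresh element, its
positive part is bounded on [P + R_-] and its negative part on [Q + R_+], and
both parts are sorted like the direction itself ([glue_max], [lift_gp_sum]).

Suppose that the glued family is a sum of coherent families [s] and [t].  The
orders that have the fresh element at the bottom see [p], those that have it
at the top see [q]; by rigidity of [p] and [q], the family [s] restricts there
to [a *: p + u] and to [b *: q + u'].  A coordinate of a coherent family
depends only on the set of elements above it ([coherent_local]), so these two
restrictions determine all the first [n] coordinates of [s]; and a coordinate
can only grow when the fresh element passes from above it to below it, which
is submodularity ([coherent_monotone]).  Applied to both [s] and [t], this
forces [a *: p + u] and [b *: q + u'] to agree wherever [p] and [q] do.  The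
two equalities at [j] give [a = b], and one equality in each coordinate gives
[u = u'] ([rigid_glue]).

For fertility, consider the points [(P^s_j, Q^s_j)] of the plane, for a fixed
[j].  The seeds are the positive slopes of the edges on the upper left boundary
of their convex hull, and there is none exactly when one of these points is
both leftmost and highest ([fertileP]).  For the offspring of [(P, Q)] and of
[(P', Q')], the least value of coordinate [j] on the first is attained on the
[q] of [(P, Q)] and the greatest one on the second on the [p] of [(P', Q')].
Hence an order attaining both would restrict to an order minimizing [Q_j] and
maximizing [P'_j], which a suitable [j] excludes as [(Q, P')] is fertile
([offspring_fertile]). *)

Set Implicit Arguments.
Unset Strict Implicit.
Unset Printing Implicit Defensive.

Import Order.TTheory GRing.Theory Num.Theory.
Import numFieldNormedType.Exports.

Local Open Scope classical_set_scope.
Local Open Scope ring_scope.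

(** * Inner product *)

Section Dotp.
Variables (R : realType) (n : nat).
Implicit Types (x y c d : 'rV[R]_n) (a : R).

Lemma dotpC x y : dotp x y = dotp y x.
Proof. by apply: eq_bigr => i _; rewrite mulrC. Qed.

Lemma dotpDl x y c : dotp (x + y) c = dotp x c + dotp y c.
Proof.
by rewrite /dotp -big_split; apply: eq_bigr => i _; rewrite mxE mulrDl.
Qed.

Lemma dotpZl a x c : dotp (a *: x) c = a * dotp x c.
Proof.
by rewrite /dotp mulr_sumr; apply: eq_bigr => i _; rewrite mxE mulrA.
Qed.

Lemma dotpNl x c : dotp (- x) c = - dotp x c.
Proof. by rewrite -scaleN1r dotpZl mulN1r. Qed.

Lemma dotpBl x y c : dotp (x - y) c = dotp x c - dotp y c.
Proof. by rewrite dotpDl dotpNl. Qed.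

Lemma dotpDr x c d : dotp x (c + d) = dotp x c + dotp x d.
Proof. by rewrite !(dotpC x) dotpDl. Qed.

Lemma dotpZr a x c : dotp x (a *: c) = a * dotp x c.
Proof. by rewrite !(dotpC x) dotpZl. Qed.

Lemma dotpBr x c d : dotp x (c - d) = dotp x c - dotp x d.
Proof. by rewrite !(dotpC x) dotpBl. Qed.

Lemma dotpNr x c : dotp x (- c) = - dotp x c.
Proof. by rewrite !(dotpC x) dotpNl. Qed.

Lemma dotpBB x y :
  dotp (x - y) (x - y) = dotp x x - 2 * dotp x y + dotp y y.
Proof. rewrite dotpBl !dotpBr (dotpC y x); ring. Qed.

Lemma dotp0l c : dotp 0 c = 0.
Proof. by rewrite -(scale0r 0) dotpZl mul0r. Qed.

Lemma dotp0r x : dotp x 0 = 0.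
Proof. by rewrite dotpC dotp0l. Qed.

Lemma dotp_e x (i : 'I_n) : dotp x (e_ R i) = x ord0 i.
Proof.
rewrite /dotp (bigD1 i) //= big1 ?addr0; first by rewrite mxE !eqxx mulr1.
by move=> j /negPf ji; rewrite mxE ji andbF mulr0.
Qed.

Lemma dotp_ge0 x : 0 <= dotp x x.
Proof. by apply: sumr_ge0 => i _; rewrite -expr2 sqr_ge0. Qed.

Lemma dotp_eq0 x : (dotp x x == 0) = (x == 0).
Proof.
apply/idP/eqP => [|->]; last by rewrite dotp0l.
rewrite /dotp psumr_eq0 => [/allP h|i _]; last by rewrite -expr2 sqr_ge0.
apply/rowP => i; rewrite mxE; apply/eqP.
by have := h i (mem_index_enum _); rewrite -expr2 sqrf_eq0.
Qed.

Lemma dotp_gt0 x : (0 < dotp x x) = (x != 0).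
Proof. by rewrite lt_def dotp_ge0 andbT dotp_eq0. Qed.

End Dotp.

(** * Convex hulls and separation *)

Lemma seq_argmax (R : realType) (T : eqType) (X : seq T) (f : T -> R) x0 :
  x0 \in X -> exists2 m, m \in X & forall x, x \in X -> f x <= f m.
Proof.
elim: X x0 => // x X IH x0 _.
case: X IH => [_|x1 X /(_ x1)].
  by exists x => [|y]; rewrite inE // => /eqP ->.
rewrite inE eqxx => /(_ isT) [m mX hm].
have [fx|fx] := leP (f x) (f m).
  by exists m => [|y]; rewrite inE ?mX ?orbT // => /orP[/eqP ->|/hm].
exists x => [|y]; rewrite inE ?eqxx // => /orP[/eqP -> //|/hm].
by move/le_trans; apply; exact: ltW.
Qed.

Section Hull.
Variables (R : realType) (n : nat).
Implicit Types (x y c d : 'rV[R]_n) (A B X : set 'rV[R]_n).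

Lemma convex_setP A : @convex_set R 'rV[R]_n A <->
  (forall x y k, 0 < k -> k < 1 -> A x -> A y -> A (k *: x + (1 - k) *: y)).
Proof.
rewrite convex_setW; split=> [h x y k k0 k1 Ax Ay|h x y xA yA k k0 k1].
  have := h x y (mem_set Ax) (mem_set Ay) (Itv01 (ltW k0) (ltW k1)) k0 k1.
  by rewrite inE.
- by rewrite inE; apply: h => //; rewrite -inE.
Qed.

Lemma sub_hull X : X `<=` conv_hull X.
Proof. exact: sub_gen_smallest. Qed.

Lemma hull_sub X A : @convex_set R 'rV[R]_n A -> X `<=` A -> conv_hull X `<=` A.
Proof. exact: smallest_sub. Qed.

Lemma hull_convex X : @convex_set R 'rV[R]_n (conv_hull X).
Proof.
apply/convex_setP => x y k k0 k1 hx hy A [cA XA].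
by move/convex_setP : (cA); apply => //; [apply: hx|apply: hy].
Qed.

Lemma hullS X A : X `<=` A -> conv_hull X `<=` conv_hull A.
Proof.
move=> XA; apply: (hull_sub (@hull_convex A)).
exact: subset_trans XA (@sub_hull A).
Qed.

Lemma hull_le X c (M : R) :
  (forall x, X x -> dotp x c <= M) -> forall x, conv_hull X x -> dotp x c <= M.
Proof.
move=> h; apply: (@hull_sub X [set x | dotp x c <= M]) => //.
apply/convex_setP => x y k k0 k1 /= hx hy; rewrite dotpDl !dotpZl; nra.
Qed.

(** A face of a convex hull is spanned by the generators that it contains: the
points that are either strictly below the maximum or in the span of these
generators form a convex set. *)
Lemma hull_face X c (M : R) :
  (forall x, X x -> dotp x c <= M) ->
  forall x, conv_hull X x -> dotp x c = M ->
    conv_hull (X `&` [set x | dotp x c = M]) x.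
Proof.
move=> h; set F := conv_hull (X `&` _).
suff H : conv_hull X `<=` [set x | dotp x c < M \/ dotp x c = M /\ F x].
  by move=> x /H [lt eq|[_ Fx]] //; rewrite eq ltxx in lt.
apply: hull_sub => [|x Xx]; last first.
  have := h x Xx; rewrite le_eqVlt => /orP[/eqP e|e]; last by left.
  by right; split => //; apply: sub_hull.
apply/convex_setP => x y k k0 k1 /= hx hy; rewrite !dotpDl !dotpZl.
case: hx => [hx|[hx Fx]].
  left; have hy2 : dotp y c <= M.
    by case: hy => [/ltW|[-> _]].

  by nra.
case: hy => [hy|[hy Fy]]; first by left; nra.
right; split; first by rewrite hx hy; ring.
by move/convex_setP: (hull_convex (X:=X `&` [set x | dotp x c = M])); apply.
Qed.

Lemma mink_sum_convex A B :
  @convex_set R 'rV[R]_n A -> @convex_set R 'rV[R]_n B ->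
  @convex_set R 'rV[R]_n (mink_sum A B).
Proof.
move=> /convex_setP cA /convex_setP cB; apply/convex_setP.
move=> _ _ k k0 k1 [x1 hx1 [y1 hy1 <-]] [x2 hx2 [y2 hy2 <-]].
exists (k *: x1 + (1 - k) *: x2); first exact: cA.
exists (k *: y1 + (1 - k) *: y2); first exact: cB.
by rewrite !scalerDr addrACA.
Qed.

Lemma sum_continuous (T : topologicalType) (I : finType) (F : I -> T -> R) :
  (forall i, continuous (F i)) -> continuous (fun t => \sum_i F i t).
Proof.
move=> cF; apply: (@continuous_big R) => [p|i _]; last exact: cF.
by apply: cvgD; [exact: cvg_fst|exact: cvg_snd].
Qed.

Lemma convex_sum_hull (I : finType) (x : I -> 'rV[R]_n) (a : I -> R) :
  (forall i, 0 <= a i) -> \sum_i a i = 1 ->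
  conv_hull (range x) (\sum_i a i *: x i).
Proof.
move=> a0 a1.
suff H (s : seq I) : 0 < \sum_(i <- s) a i ->
    conv_hull (range x) ((\sum_(i <- s) a i)^-1 *: \sum_(i <- s) a i *: x i).
  by have := H (index_enum I); rewrite a1 invr1 scale1r; apply; rewrite ltr01.
elim: s => [|i s IH]; first by rewrite big_nil ltxx.
rewrite !big_cons; set S := \sum_(i <- s) a i in IH *.
have S0 : 0 <= S by apply: sumr_ge0.
have hi : conv_hull (range x) (x i) by apply: sub_hull; exists i.
case: (ltgtP S 0) S0 => // [S0 _|S0 _].
- have := a0 i; rewrite le_eqVlt => /orP[/eqP <- _|ai _].
    by rewrite scale0r !add0r; exact: IH.
  have E : a i + S != 0 by rewrite gt_eqF // addr_gt0.
  have -> : (a i + S)^-1 *: (a i *: x i + \sum_(j <- s) a j *: x j) =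
     (a i / (a i + S)) *: x i +
     (1 - a i / (a i + S)) *: (S^-1 *: \sum_(j <- s) a j *: x j).
    rewrite scalerDr !scalerA mulrC; congr (_ *: _ + _ *: _); field.
    by rewrite E gt_eqF.
  move/convex_setP: (@hull_convex (range x)); apply => //; last exact: IH.
  + by rewrite divr_gt0 // addr_gt0.
  + by rewrite ltr_pdivrMr ?addr_gt0 // mul1r ltrDl.
- rewrite S0 addr0 => ai.
  rewrite big1_seq ?addr0 ?scalerA ?mulVf ?scale1r ?gt_eqF // => j /= js.
  have -> : a j = 0; last by rewrite scale0r.
  apply/eqP; rewrite eq_le a0 andbT -S0 /S (big_rem j) //= lerDl.
  by apply: sumr_ge0.
Qed.

(** If no linear form separates [y] from a finite set, then [y] is in its hull:
otherwise the direction from the nearest point [z a] of the hull to [y] would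
separate them.  The nearest point is found by minimizing over the compact
simplex of weights. *)
Lemma separation (I : finType) (x : I -> 'rV[R]_n) y :
  (forall c, exists i, dotp y c <= dotp (x i) c) -> conv_hull (range x) y.
Proof.
move=> h; pose k := #|I|.
pose w (a : 'rV[R]_k) (i : I) : R := a ord0 (enum_rank i).
pose z a : 'rV[R]_n := \sum_i w a i *: x i.
pose f a := dotp (y - z a) (y - z a).
pose A := [set a : 'rV[R]_k | forall i, `[0, 1]%classic (a ord0 i)] `&`
          [set a : 'rV[R]_k | \sum_i w a i = 1].
have wc i : continuous (w^~ i).
  by move=> a; apply: coord_continuous.
have [i0 _] := h 0.
have A0 : A !=set0.
  exists (\row_j (j == enum_rank i0)%:R); split=> [j|] /=.
    by rewrite in_itv /= mxE; case: (_ == _); rewrite ?lexx ler01.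
  rewrite (bigD1 i0) //= big1 ?addr0 ?/w ?mxE ?eqxx // => j ji.
  by rewrite mxE (inj_eq enum_rank_inj) (negPf ji).
have cA : compact A.
  apply: compact_closedI.
    apply: (@rV_compact R k (fun=> [set` `[0, 1]])) => _.
    exact: segment_compact.
  apply: (@closed_comp _ _ (fun a => \sum_i w a i) [set 1]) => [a _|].
    exact: sum_continuous wc a.
  exact: closed_eq.
have cf : continuous f.
  apply: sum_continuous => j.
  have H : continuous (fun a => (y - z a) ord0 j).
    rewrite (_ : (fun _ => _) =
                 (fun a => y ord0 j - \sum_i w a i * x i ord0 j)).
      have cst (u : R) : continuous (fun _ : 'rV[R]_k => u).
        exact: cst_continuous.
      move=> a; apply: (@continuousB R R^o); first exact: cst.
      apply: sum_continuous => i b.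
      by apply: (@continuousM R); [exact: wc|exact: cst].
    apply/funext => b; rewrite !mxE summxE; congr (_ - _).
    by apply: eq_bigr => i _; rewrite mxE.
  by move=> a; apply: (@continuousM R _ (fun a => (y - z a) ord0 j)); exact: H.
have [a /[!inE] -[a01 /= a1] amin] :=
  EVT_min_rV A0 cA (continuous_subspaceT cf).
set d := y - z a.
(* moving from the nearest point towards a generator cannot come closer *)
have P i : dotp d (x i - z a) <= 0.
  set e := x i - z a; rewrite leNgt; apply/negP => de.
  have e0 := dotp_ge0 e.
  (* any small enough step would do; this one lies in ]0, 1] *)
  pose t := dotp d e / (dotp d e + dotp e e).
  have t0 : 0 < t by rewrite divr_gt0 // ltr_wpDr.
  have t1 : t <= 1 by rewrite ler_pdivrMr ?ltr_wpDr // mul1r lerDl.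
  have te : t * dotp e e <= dotp d e.
    by rewrite /t mulrAC ler_pdivrMr ?ltr_wpDr // ler_pM2l // lerDr ltW.
  pose b := (1 - t) *: a + t *: \row_j (j == enum_rank i)%:R.
  have wb j : w b j = (1 - t) * w a j + t * (j == i)%:R.
    by rewrite /w !mxE (inj_eq enum_rank_inj).
  have sd (V : lmodType R) (F : I -> V) : \sum_j (j == i)%:R *: F j = F i.
    rewrite (bigD1 i) //= eqxx scale1r big1 ?addr0 // => j /negPf ->.
    by rewrite scale0r.
  have Ab : A b.
    split=> [j|] /=.
      have /= := a01 j; rewrite !in_itv /= !mxE => /andP[aj0 aj1].
      by case: (_ == _); apply/andP; split; rewrite ?mulr0 ?mulr1; nra.
    under eq_bigr do rewrite wb.
    rewrite big_split /= -!mulr_sumr a1.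
    have := sd R^o (fun=> 1); rewrite (eq_bigr (fun j => (j == i)%:R)).
      by move=> ->; ring.
    by move=> j _; exact: mulr1.
  have zb : y - z b = d - t *: e.
    have -> : z b = (1 - t) *: z a + t *: x i.
      rewrite /z -(sd _ x) !scaler_sumr -big_split /=; apply: eq_bigr => j _.
      by rewrite wb [LHS]scalerDl !scalerA.
    rewrite /d /e; apply/rowP => j; rewrite !mxE; ring.
  have := amin b (mem_set Ab); rewrite /f zb -/d.
  rewrite (dotpBB d (t *: e)) dotpZr dotpZl dotpZr; nra.
have [i hi] := h d.
have d0 : d = 0.
  apply/eqP; rewrite -dotp_eq0 eq_le dotp_ge0 andbT.
  have := P i; rewrite {2}/d dotpBl; move: hi; rewrite dotpBr.
  rewrite !(dotpC _ d); lra.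
have -> : y = z a by apply/eqP; rewrite -subr_eq0 -/d d0.
apply: convex_sum_hull => // j; have := a01 (enum_rank j).
by rewrite /= in_itv /= => /andP[].
Qed.

End Hull.

(** * Braid cones as linear orders *)

Section Cones.
Variables (R : realType) (n : nat).
Implicit Types (c d x y : 'rV[R]_n) (s t : 'S_n) (K L : seq 'rV[R]_n).

(** The position of [a] in the linear order that [s] encodes; everything about
a permutation below is expressed through this order. *)
Definition rank s (a : 'I_n) : nat := (s^-1)%g a.

Definition strict_cone s : set 'rV[R]_n :=
  [set c | forall a b, (rank s a < rank s b)%N -> c ord0 a < c ord0 b].

Lemma rankK s (i : 'I_n) : rank s (s i) = i.
Proof. by rewrite /rank permK. Qed.

Lemma rank_inj s : injective (rank s).
Proof. by move=> a b /val_inj /perm_inj. Qed.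

Lemma braid_coneP s c : braid_cone s c <->
  forall a b, (rank s a <= rank s b)%N -> c ord0 a <= c ord0 b.
Proof.
split=> h a b; last by move=> ab; apply: h; rewrite !rankK.
by move=> /h; rewrite !permKV.
Qed.

Lemma strict_cone_braid s c : strict_cone s c -> braid_cone s c.
Proof.
move=> h; apply/braid_coneP => a b; rewrite leq_eqVlt.
move=> /orP[/eqP/rank_inj -> //|].
by move=> /h/ltW.
Qed.

Lemma distinct_strict_cone s c : braid_cone s c ->
  (forall a b, a != b -> c ord0 a != c ord0 b) -> strict_cone s c.
Proof.
move=> /braid_coneP h neq a b ab; rewrite lt_neqAle h ?andbT ?(ltnW ab) //.
by apply: neq; apply: contraTneq ab => ->; rewrite ltnn.
Qed.

Lemma sorting_key (disp : Order.disp_t) (T : orderType disp) (f : 'I_n -> T) :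
  exists s, forall a b, (rank s a <= rank s b)%N -> (f a <= f b)%O.
Proof.
pose le := [rel a b : 'I_n | (f a <= f b)%O].
have tot : total le by move=> a b; exact: le_total.
have tr : transitive le by move=> a b e; exact: le_trans.
have /tuple_permP[s es] : perm_eq (sort le (ord_tuple n)) (ord_tuple n).
  by rewrite perm_sort.
exists s => a b ab.
have := sort_sorted tot (ord_tuple n).
rewrite es => /(sorted_leq_nth tr (fun a => lexx (f a)) a).
move=> /(_ (rank s a) (rank s b)); rewrite !inE size_tuple !ltn_ord.
move=> /(_ isT isT ab) /=.
rewrite !(nth_map a) -?enumT ?size_enum_ord ?ltn_ord //.
by rewrite !nth_ord_enum !tnth_ord_tuple !permKV.
Qed.

Lemma sorting c : exists s, braid_cone s c.
Proof.
by have [s h] := sorting_key (fun a => c ord0 a); exists s; apply/braid_coneP.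
Qed.

(** An order-preserving bijection between finite chains cannot decrease ranks;
with its inverse, this makes it the identity. *)
Lemma rank_homo_le s t :
  (forall a b, (rank s a <= rank s b)%N -> (rank t a <= rank t b)%N) ->
  forall a, (rank s a <= rank t a)%N.
Proof.
move=> h a; move: {2}(rank s a) (leqnn (rank s a)) => k.
elim: k a => [|k IH] a; first by rewrite leqn0 => /eqP ->.
rewrite leq_eqVlt ltnS => /orP[/eqP ak|]; last exact: IH.
have kn : (k < n)%N by have := ltn_ord ((s^-1)%g a); rewrite -/(rank s a); lia.
pose b := s (Ordinal kn); have bk : rank s b = k by rewrite rankK.
have := IH b; rewrite bk leqnn => /(_ isT) kb.
have := h b a; rewrite bk ak leqnSn => /(_ isT).
rewrite leq_eqVlt => /orP[/eqP/rank_inj ba|]; last by lia.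
by move: bk; rewrite ba; lia.
Qed.

Lemma rank_le_inj s t :
  (forall a b, (rank s a <= rank s b)%N -> (rank t a <= rank t b)%N) -> s = t.
Proof.
move=> h; suff E a : rank s a = rank t a.
  by apply/invg_inj/permP => a; apply: val_inj; exact: E.
apply/eqP; rewrite eqn_leq rank_homo_le //= rank_homo_le // => {}a b.
apply: contraTT; rewrite -!ltnNge => ba.
rewrite ltn_neqAle h ?(ltnW ba) // andbT.
by apply: contraTneq ba => /rank_inj ->; rewrite ltnn.
Qed.

Lemma small_perturbation K c d : (forall k, k \in K -> 0 < dotp c k) ->
  exists2 e : R, 0 < e & forall k, k \in K -> 0 < dotp (c + e *: d) k.
Proof.
elim: K => [|k K IH] h; first by exists 1.
have [l lK|e e0 he] := IH; first by apply: h; rewrite inE lK orbT.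
have k0 : 0 < dotp c k by apply: h; rewrite inE eqxx.
pose e' := dotp c k / (dotp c k + `|dotp d k|).
have D : 0 < dotp c k + `|dotp d k| by rewrite ltr_wpDr.
have e'0 : 0 < e' by rewrite divr_gt0.
have lin l : 0 < dotp c l -> forall f g, 0 < f -> f <= g ->
    0 < dotp (c + g *: d) l -> 0 < dotp (c + f *: d) l.
  by move=> l0 f g f0 fg; rewrite !dotpDl !dotpZl; nra.
exists (Num.min e e' / 2) => [|l].
  by rewrite divr_gt0 // lt_min e0 e'0.
have m0 : 0 < Num.min e e' by rewrite lt_min e0 e'0.
have me : Num.min e e' <= e by rewrite ge_min lexx.
have me' : Num.min e e' <= e' by rewrite ge_min lexx orbT.
rewrite inE => /orP[/eqP ->|lK].
  apply: (lin _ _ _ (e' / 2)); [by []|lra|lra|].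
  rewrite dotpDl dotpZl.
  have E : e' * (dotp c k + `|dotp d k|) = dotp c k.
    by rewrite /e' divfK // gt_eqF.
  have := ler_norm (- dotp d k); rewrite normrN; nra.
apply: (lin _ _ _ e); [|lra|lra|exact: he].
by apply: h; rewrite inE lK orbT.
Qed.

(** Finitely many open half-spaces and complements of hyperplanes: the forms of
[L] are dealt with one at a time, and once [c] is moved off a hyperplane the
side on which it lies joins the list [K] of inequalities to be preserved. *)
Lemma generic_vector K L c : (forall k, k \in K -> 0 < dotp c k) ->
  (forall l, l \in L -> l != 0) ->
  exists c', (forall k, k \in K -> 0 < dotp c' k) /\
             (forall l, l \in L -> dotp c' l != 0).
Proof.
elim: L K c => [|l L IH] K c hK hL; first by exists c.
have l0 : l != 0 by apply: hL; rewrite inE eqxx.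
have [c1 [h1 l1]] : exists c1,
    (forall k, k \in K -> 0 < dotp c1 k) /\ dotp c1 l != 0.
  have [cl|] := eqVneq (dotp c l) 0; last by exists c.
  have [e e0 he] := small_perturbation l hK; exists (c + e *: l); split=> //.
  by rewrite dotpDl dotpZl cl add0r mulf_neq0 ?gt_eqF // dotp_gt0.
have {}hL m : m \in L -> m != 0 by move=> mL; apply: hL; rewrite inE mL orbT.
pose l' := if 0 < dotp c1 l then l else - l.
have l'0 : 0 < dotp c1 l'.
  rewrite /l'; case: ifP => // /negbT; rewrite -leNgt dotpNr oppr_gt0.
  by rewrite le_eqVlt (negPf l1).
have [k|c2 [h2 L2]] := IH (l' :: K) c1 _ hL.
  by rewrite inE => /orP[/eqP -> //|/h1].
exists c2; split=> [k kK|m]; first by apply: h2; rewrite inE kK orbT.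
rewrite inE => /orP[/eqP ->|/L2 //].
have := h2 l'; rewrite inE eqxx => /(_ isT); rewrite /l'.
case: ifP => _; first by move/gt_eqF ->.
by rewrite dotpNr oppr_gt0 => /lt_eqF ->.
Qed.

(** The finitely many inequalities of the open braid cone, in the form that
[small_perturbation] and [generic_vector] preserve. *)
Definition braid_roots s : seq 'rV[R]_n :=
  [seq e_ R p.2 - e_ R p.1 |
     p : 'I_n * 'I_n <- enum {: 'I_n * 'I_n} & (rank s p.1 < rank s p.2)%N].

Lemma braid_rootsP s c :
  strict_cone s c <-> (forall k, k \in braid_roots s -> 0 < dotp c k).
Proof.
split=> [h k /mapP[[a b]]|h a b ab].
  by rewrite mem_filter => /andP[/= ab _] ->; rewrite dotpBr !dotp_e subr_gt0 h.
rewrite -subr_gt0 -!dotp_e -dotpBr; apply: h.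
by apply/mapP; exists (a, b); rewrite // mem_filter /= ab mem_enum.
Qed.

Definition rank_vector s : 'rV[R]_n := \row_a (rank s a)%:R.

Lemma rank_vector_strict s : strict_cone s (rank_vector s).
Proof. by move=> a b; rewrite !mxE ltr_nat. Qed.

Lemma strict_cone_interior s c : strict_cone s c -> (braid_cone s)° c.
Proof.
move=> h; have [e e0 he] : exists2 e : R, 0 < e &
    forall a b, (rank s a < rank s b)%N -> e < c ord0 b - c ord0 a.
  have /braid_rootsP hr := h.
  have [e e0 he] := small_perturbation (- rank_vector s) hr.
  exists e => // a b ab.
  have /braid_rootsP := he => /(_ a b ab); rewrite !mxE => H.
  have : (rank s a)%:R + 1 <= (rank s b)%:R :> R by rewrite natr1 ler_nat.
  nra.
apply/nbhs_ballP; exists (e / 2) => /=; first by rewrite divr_gt0.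
move=> c' [_ H]; apply/braid_coneP => a b; rewrite leq_eqVlt.
move=> /orP[/eqP/rank_inj -> //|ab].
have := he a b ab; have := H ord0 a; have := H ord0 b.
rewrite /ball /= !ltr_norml => /andP[? ?] /andP[? ?]; lra.
Qed.

(** A direction interior to the cone can be moved towards [y - z] without
leaving it, so two points that both maximize there must coincide. *)
Lemma strict_cone_unique s c y z : strict_cone s c ->
  (forall c', strict_cone s c' -> dotp y c' <= dotp z c') ->
  dotp z c <= dotp y c -> y = z.
Proof.
move=> /braid_rootsP sc h zy.
have [e e0 /braid_rootsP he] := small_perturbation (y - z) sc.
have := h _ he; rewrite !dotpDr !dotpZr => H.
apply/eqP; rewrite -subr_eq0 -dotp_eq0 eq_le dotp_ge0 andbT dotpBl.
by rewrite -(ler_pM2l e0) mulr0; nra.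
Qed.

End Cones.
Arguments rank_vector_strict R {n} s [a b] _.

(** * Deformed permutahedra as coherent families *)

Section Coherent.
Variables (R : realType) (n : nat).
Implicit Types (c d x y : 'rV[R]_n) (s t : 'S_n) (v : 'S_n -> 'rV[R]_n).

(** The closed cones matter here: directions such as indicator vectors of upper
sets, which lie on the boundary of many cones, relate distinct vertices. *)
Definition coherent v :=
  forall s t c, braid_cone s c -> dotp (v t) c <= dotp (v s) c.

Lemma coherent_hull v s c y : coherent v -> braid_cone s c ->
  conv_hull (range v) y -> dotp y c <= dotp (v s) c.
Proof. by move=> cv sc; apply: hull_le => _ [t _ <-]; exact: cv. Qed.

Lemma coherent_unique v s c y : coherent v -> strict_cone s c ->
  conv_hull (range v) y -> dotp (v s) c <= dotp y c -> y = v s.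
Proof.
move=> cv sc hy; apply: strict_cone_unique (sc) _ => c' /strict_cone_braid sc'.
exact: coherent_hull.
Qed.

Lemma vert_hull v : coherent v -> vert (conv_hull (range v)) = v.
Proof.
move=> cv; apply/funext => s.
apply: xget_unique => [c /interior_subset sc|y hy].
  split=> [|y]; first by apply: sub_hull; exists s.
  exact: coherent_hull.
have sc := rank_vector_strict R s.
have [Py] := hy _ (strict_cone_interior sc).
move=> /(_ (v s)) hs; apply: coherent_unique (cv) (sc) (Py) _.
by apply: hs; apply: sub_hull; exists s.
Qed.

Lemma coherent_polytope v : polytope (conv_hull (range v)).
Proof.
exists (range v); split=> //; last by exists (v 1%g), 1%g.
exact/finite_image/finite_finset.
Qed.

(** The orthogonal projection along [d]. *)
Let proj d x := x - (dotp x d / dotp d d) *: d.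

Let proj_adj d x y : dotp (proj d x) y = dotp x (proj d y).
Proof.
by rewrite /proj dotpBl dotpBr dotpZl dotpZr (dotpC d) (dotpC y d); ring.
Qed.

Let proj_orth d c x : dotp d c = 0 -> dotp c (proj d x) = dotp c x.
Proof.
by move=> dc; rewrite /proj dotpBr dotpZr (dotpC c d) dc mulr0 subr0.
Qed.

Let proj_id d x : d != 0 -> dotp (proj d x) d = 0.
Proof.
by move=> d0; rewrite /proj dotpBl dotpZl divfK ?subrr // dotp_eq0.
Qed.

(** If the direction [d] of an edge is not a root, the hyperplane orthogonal to
[d] contains directions with distinct coordinates, even close to one that
exposes the edge.  They still expose nothing outside the edge, take the same
value at both ends, and yet have a unique maximizer. *)
Lemma coherent_edge v a b : coherent v ->
  is_edge (conv_hull (range v)) a b ->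
  exists i j k, b - a = k *: (e_ R i - e_ R j).
Proof.
move=> cv [ab [c Ec]]; set P := conv_hull _ in Ec.
have [Pa amax] : max_face P c a by rewrite Ec; apply: sub_hull; left.
have [Pb bmax] : max_face P c b by rewrite Ec; apply: sub_hull; right.
apply: contrapT => nroot; set d := b - a.
have d0 : d != 0 by rewrite subr_eq0 eq_sym.
have dc : dotp d c = 0.
  by apply/eqP; rewrite dotpBl subr_eq0 eq_le amax // bmax.
pose K := [seq proj d (a - v s) | s <- enum 'S_n & 0 < dotp c (a - v s)].
pose L := [seq proj d (e_ R p.1 - e_ R p.2) |
            p <- enum {: 'I_n * 'I_n} & p.1 != p.2].
(* K keeps the edge exposed, L separates the coordinates; genericity inside
   the hyperplane is obtained by projecting both lists *)
have [k|l|c2 [c2K c2L]] := @generic_vector R n K L c.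
- by case/mapP => s; rewrite mem_filter => /andP[h _] ->; rewrite proj_orth.
- case/mapP => -[i j]; rewrite mem_filter => /andP[/= ij _] ->.
  apply/negP => /eqP; rewrite /proj => /eqP; rewrite subr_eq0.
  set k := _ / _ => /eqP eij; apply: nroot; exists i, j, k^-1.
  have k0 : k != 0.
    apply: contra_neq ij => k0; move/rowP/(_ i): eij.
    rewrite k0 scale0r !mxE !eqxx.
    by case: eqVneq => // _ /eqP; rewrite subr0 oner_eq0.
  by rewrite eij scalerA mulVf // scale1r.
set c' := proj d c2.
have [s sc'] := sorting c'.
have {}sc' : strict_cone s c'.
  apply: distinct_strict_cone sc' _ => i j ij.
  rewrite -subr_eq0 -!dotp_e -dotpBr proj_adj; apply: c2L.
  by apply/mapP; exists (i, j); rewrite // mem_filter /= ij mem_enum.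
have Ps : P (v s) by apply: sub_hull; exists s.
have max_s y : P y -> dotp y c' <= dotp (v s) c'.
  exact: coherent_hull (strict_cone_braid sc').
have sE : dotp (v s) c = dotp a c.
  apply/eqP; rewrite eq_le amax //= leNgt; apply/negP => lt.
  have := max_s a Pa; apply/negP; rewrite -ltNge -subr_gt0 -dotpBl dotpC.
  rewrite proj_adj; apply: c2K; apply/mapP; exists s => //.
  by rewrite mem_filter mem_enum andbT dotpC dotpBl subr_gt0.
have ba : dotp b c' = dotp a c'.
  by apply/eqP; rewrite -subr_eq0 -dotpBl dotpC proj_id.
have le_s : dotp (v s) c' <= dotp a c'.
  have : max_face P c (v s) by split=> // y /amax; rewrite sE.
  rewrite Ec; apply: hull_le => _ [->|->]; by rewrite ?ba.
have ea := coherent_unique cv sc' Pa le_s.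
have eb : b = v s by apply: (coherent_unique cv sc' Pb); rewrite ba.
by move: ab; rewrite {1}ea eb eqxx.
Qed.

Lemma coherent_deformed v : coherent v ->
  deformed_permutahedron (conv_hull (range v)).
Proof.
move=> cv; split; first exact: coherent_polytope.
by move=> a b; exact: coherent_edge.
Qed.

(** A step of the simplex method: from a vertex [v], exposed by [c0], that does
not maximize [c1], some edge leaves along which [c1] increases.  On the way
from [c0] to [c1], the first direction that does not expose [v] alone is found
by a ratio test; for generic [c0], it exposes an edge because ties only occur
along a common ray from [v]. *)
Lemma pivot (X K : seq 'rV[R]_n) (v c0 c1 x1 : 'rV[R]_n) : v \in X ->
  (forall x, x \in X -> x != v -> 0 < dotp c0 (v - x)) ->
  (forall k, k \in K -> 0 < dotp c0 k) ->
  x1 \in X -> 0 < dotp c1 (x1 - v) ->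
  exists w c0', [/\ is_edge (conv_hull [set` X]) v w,
    forall k, k \in K -> 0 < dotp c0' k,
    dotp c0' (w - v) < 0 & 0 < dotp c1 (w - v)].
Proof.
move=> vX vmax Kpos x1X x1v.
(* c0 is orthogonal to del x y exactly when x and y tie in the ratio test,
   and del x y vanishes only if x - v and y - v are parallel *)
pose del x y := dotp c1 (x - v) *: (v - y) - dotp c1 (y - v) *: (v - x).
pose K' := K ++ [seq v - x | x <- X & x != v].
pose L := [seq l <- [seq del x y | x <- X, y <- X] | l != 0].
have [k|l|c [cK cL]] := @generic_vector R n K' L c0.
- rewrite mem_cat => /orP[/Kpos //|/mapP[x]].
  by rewrite mem_filter => /andP[xv xX] ->; exact: vmax.
- by rewrite mem_filter => /andP[].
have cv x : x \in X -> x != v -> 0 < dotp c (v - x).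
  move=> xX xv; apply: cK; rewrite mem_cat; apply/orP; right.
  by apply/mapP; exists x; rewrite // mem_filter xv.
have cdel x y : x \in X -> y \in X -> dotp c (del x y) = 0 -> del x y = 0.
  move=> xX yX e; apply/eqP; apply: contra_eqT e => nz; apply: cL.
  by rewrite mem_filter nz; apply/allpairsP; exists (x, y).
have up_neq x : 0 < dotp c1 (x - v) -> x != v.
  by apply: contraTneq => ->; rewrite subrr dotp0r ltxx.
pose ratio x := dotp c1 (x - v) / dotp c (v - x).
pose Y := [seq x <- X | 0 < dotp c1 (x - v)].
have x1Y : x1 \in Y by rewrite mem_filter x1v.
have [m] := seq_argmax ratio x1Y.
rewrite mem_filter => /andP[mv mX] mmax; pose r := ratio m.
have r0 : 0 < r by rewrite divr_gt0 ?cv ?up_neq.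
pose ct := c1 + r *: c.
have ctE x : dotp ct (x - v) = dotp c1 (x - v) - r * dotp c (v - x).
  by rewrite /ct dotpDl dotpZl -(opprB x v) dotpNr; ring.
pose M := [seq x <- Y | ratio x == r].
have [w wM wmax] := @seq_argmax R _ M (fun x => dotp c1 (x - v)) m
  ltac:(by rewrite !mem_filter eqxx mv).
move: (wM); rewrite !mem_filter => /and3P[/eqP rw wv wX].
exists w, c; split=> //.
- split; first by rewrite eq_sym up_neq.
  exists ct.
  have leX x : x \in X -> dotp ct (x - v) <= 0.
    move=> xX; rewrite ctE; have [->|xv] := eqVneq x v.
      by rewrite subrr !dotp0r mulr0 subr0.
    have c0x := cv x xX xv.
    have [up|] := ltP 0 (dotp c1 (x - v)); last by nra.
    by rewrite subr_le0 -ler_pdivrMr // mmax // mem_filter up.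
  have eqX x : x \in X -> dotp ct (x - v) = 0 -> x = v \/ x \in M.
    move=> xX; rewrite ctE; have [->|xv] := eqVneq x v; first by left.
    have c0x := cv x xX xv => e; right; rewrite !mem_filter xX andbT.
    have up : 0 < dotp c1 (x - v) by nra.
    rewrite up andbT /ratio; apply/eqP/(canLR (mulfK _)); last lra.
    by rewrite gt_eqF.
  have segM x : x \in M -> conv_hull [set v; w] x.
    move=> xM; move: (xM); rewrite !mem_filter => /and3P[/eqP rx xv xX].
    have e : del w x = 0.
      apply: cdel => //; rewrite /del [LHS]dotpBr !dotpZr.
      have := cv _ wX (up_neq _ wv); have := cv _ xX (up_neq _ xv) => p q.
      have -> : dotp c1 (x - v) = r * dotp c (v - x).
        by rewrite -rx divfK // gt_eqF.
      have -> : dotp c1 (w - v) = r * dotp c (v - w).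
        by rewrite -rw divfK // gt_eqF.
      ring.
    pose k := dotp c1 (x - v) / dotp c1 (w - v).
    have xE : x = k *: w + (1 - k) *: v.
      have kE : dotp c1 (w - v) * k = dotp c1 (x - v).
        by rewrite mulrC divfK // gt_eqF.
      apply/rowP => i; move/rowP/(_ i): e; rewrite !mxE => e.
      apply: (@mulfI _ (dotp c1 (w - v))); first by rewrite gt_eqF.
      have -> : forall A k' a b : R, A * (k' * a + (1 - k') * b) =
          (A * k') * a + A * b - (A * k') * b by move=> *; ring.
      by rewrite kE; move: e; lra.
    have := wmax x xM => le; have k0 : 0 < k by rewrite divr_gt0.
    have : k <= 1 by rewrite ler_pdivrMr // mul1r.
    rewrite le_eqVlt => /orP[/eqP k1|k1].
      by rewrite xE k1 subrr scale0r scale1r addr0; apply: sub_hull; right.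
    rewrite xE; move/convex_setP: (@hull_convex R n [set v; w]); apply=> //.
      by apply: sub_hull; right.
    by apply: sub_hull; left.
  have ctv x : dotp x ct = dotp v ct + dotp ct (x - v).
    by rewrite dotpBr !(dotpC ct); ring.
  have hullX x : conv_hull [set` X] x -> dotp x ct <= dotp v ct.
    by apply: hull_le => {}x /= /leX; rewrite (ctv x) gerDl.
  have hv : conv_hull [set` X] v by exact: sub_hull.
  apply/seteqP; split=> x.
    move=> [hx /(_ v hv) vx]; have e : dotp x ct = dotp v ct.
      by apply/eqP; rewrite eq_le hullX.
    have := @hull_face R n [set` X] ct (dotp v ct) _ x hx e.
    move=> /(_ (fun y Xy => hullX y (sub_hull Xy))).
    apply: hull_sub; first exact: hull_convex.
    move=> y [/= yX]; rewrite (ctv y) => ey.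
    have [->|/segM //] : y = v \/ y \in M by apply: eqX => //; lra.
    by apply: sub_hull; left.
  move=> hx; have xE : dotp x ct = dotp v ct.
    have ww : dotp w ct = dotp v ct.
      rewrite (ctv w) ctE -rw /ratio divfK ?subrr ?addr0 // gt_eqF // cv //.
      exact: up_neq.
    apply/eqP; rewrite eq_le; apply/andP; split.
      by apply: hull_le hx => _ [->|->]; rewrite ?ww.
    rewrite -lerN2 -!dotpNr; apply: hull_le hx => _ [->|->] //.
    by rewrite !dotpNr ww.
  split=> [|y hy]; last by rewrite xE hullX.
  by apply: hullS hx => _ [->|->].
- by move=> k kK; apply: cK; rewrite mem_cat kK.
- by rewrite -(opprB v w) dotpNr oppr_lt0 cv // up_neq.
Qed.

(** Take the vertex exposed by a generic direction of the open cone.  If some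
direction of the closed cone were larger elsewhere, [pivot] would give an edge
[k *: (e_ i - e_ j)] along which one direction of the cone increases and a
strict one decreases, although both order [i] and [j] in the same way. *)
Lemma deformed_vertex P s : deformed_permutahedron P ->
  exists2 v, P v & forall c y, braid_cone s c -> P y -> dotp y c <= dotp v c.
Proof.
move=> [[X [/finite_seqP[{}X ->] [x0 x0X] ->]] edges].
pose L := [seq l <- [seq x - y | x <- X, y <- X] | l != 0].
have /braid_rootsP h0 := rank_vector_strict R s.
have [l|c0 [c0K c0L]] := generic_vector (L := L) h0.
  by rewrite mem_filter => /andP[].
have [v vX vmax] := seq_argmax (dotp c0) x0X.
exists v => [|c1 y sc1]; first exact: sub_hull.
apply: hull_le => {y} x1 /= x1X; rewrite leNgt; apply/negP => lt.
have [x xX xv||w [c [ed cK cw c1w]]] :=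
  @pivot X (braid_roots R s) v c0 c1 x1 vX _ c0K x1X.
- rewrite dotpBr subr_gt0 lt_neqAle vmax // andbT -subr_eq0 -dotpBr.
  apply: c0L; rewrite mem_filter subr_eq0 xv.
  by apply/allpairsP; exists (x, v).
- by rewrite dotpBr subr_gt0 !(dotpC c1).
have [i [j [a E]]] := edges _ _ ed.
move: cw c1w; rewrite E !dotpZr !dotpBr !dotp_e.
move/braid_rootsP: cK => cK; move/braid_coneP: sc1 => sc1.
have [ij|ij|/rank_inj ->] := ltngtP (rank s i) (rank s j).
- have := cK _ _ ij; have := sc1 _ _ (ltnW ij); nra.
- have := cK _ _ ij; have := sc1 _ _ (ltnW ij); nra.
- by rewrite !subrr mulr0 ltxx.
Qed.

(** Every direction is sorted by some permutation, so separation recovers the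
polytope from the points that [deformed_vertex] provides; [vert_hull] then
identifies these points with the vertices. *)
Lemma deformed_coherent P : deformed_permutahedron P ->
  coherent (vert P) /\ P = conv_hull (range (vert P)).
Proof.
move=> dP; have /choice[v hv] s : exists x, P x /\
    forall c y, braid_cone s c -> P y -> dotp y c <= dotp x c.
  by have [v] := deformed_vertex s dP; exists v.
have cv : coherent v.
  by move=> s t c sc; apply: (hv s).2 sc _; exact: (hv t).1.
have PE : P = conv_hull (range v).
  apply/seteqP; split=> y.
    move=> Py; apply: separation => c; have [s sc] := sorting c.
    by exists s; exact: (hv s).2.
  have [[X [_ _ XE]] _] := dP; rewrite XE; apply: hull_sub.
    exact: hull_convex.
  by rewrite -XE => _ [s _ <-]; exact: (hv s).1.
by rewrite [in vert P]PE [in X in _ /\ X = _]PE vert_hull.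
Qed.

End Coherent.

(** * Indecomposability as rigidity *)

Section Rigid.
Variables (R : realType) (n : nat).
Implicit Types (c x y u : 'rV[R]_n) (a : R) (v : 'S_n -> 'rV[R]_n).
Implicit Types (P Q S : set 'rV[R]_n).

(** Indecomposability, read on the vertex family. *)
Definition rigid v := forall s t, coherent s -> coherent t ->
  (forall i, s i + t i = v i) ->
  exists a u, 0 <= a /\ forall i, s i = a *: v i + u.

Lemma coherent_affine a u v :
  0 <= a -> coherent v -> coherent (fun i => a *: v i + u).
Proof.
move=> a0 cv s t c sc; rewrite !dotpDl !dotpZl lerD2r ler_wpM2l //; exact: cv.
Qed.

Lemma rigid_affine a u v : 0 < a -> rigid v -> rigid (fun i => a *: v i + u).
Proof.
move=> a0 rv s t cs ct st; have a'0 : 0 <= a^-1 by rewrite invr_ge0 ltW.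
have [i|b [w [b0 sE]]] := rv _ _
    (coherent_affine (- (a^-1 *: u)) a'0 cs) (coherent_affine 0 a'0 ct).
  rewrite addr0 addrAC -scalerDr st scalerDr scalerA mulVf ?gt_eqF // scale1r.
  by rewrite addrK.
exists b, (a *: w + u - b *: u); split=> // i.
have -> : s i = a *: (a^-1 *: s i - a^-1 *: u) + u.
  by rewrite -scalerBr scalerA divff ?gt_eqF // scale1r subrK.
by rewrite sE; apply/rowP => j; rewrite !mxE; ring.
Qed.

Lemma hull_affine a u v :
  conv_hull (range (fun i => a *: v i + u)) =
  translate (dilate a (conv_hull (range v))) u.
Proof.
apply/seteqP; split.
  apply: hull_sub => [|_ [i _ <-]]; last first.
    by exists (a *: v i) => //; exists (v i) => //; apply: sub_hull; exists i.
  apply/convex_setP => _ _ k k0 k1 [_ [x hx <-] <-] [_ [y hy <-] <-].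
  exists (a *: (k *: x + (1 - k) *: y)).
    exists (k *: x + (1 - k) *: y) => //.
    by move/convex_setP: (@hull_convex R n (range v)); apply.
  by apply/rowP => j; rewrite !mxE; ring.
set H := conv_hull (range (fun i => a *: v i + u)).
suff sub : conv_hull (range v) `<=` [set x | H (a *: x + u)].
  by move=> _ [_ [x hx <-] <-]; exact: (sub x hx).
apply: hull_sub => [|_ [i _ <-]]; last by apply: sub_hull; exists i.
apply/convex_setP => x y k k0 k1 /= hx hy.
have -> : a *: (k *: x + (1 - k) *: y) + u =
          k *: (a *: x + u) + (1 - k) *: (a *: y + u).
  by apply/rowP => j; rewrite !mxE; ring.
move/convex_setP: (@hull_convex R n (range (fun i => a *: v i + u))); exact.
Qed.

(** The hull of a pointwise sum may be smaller than the Minkowski sum in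
general; coherence makes a single index maximize both summands. *)
Lemma hull_mink_sum s t v : coherent s -> coherent t ->
  (forall i, s i + t i = v i) ->
  conv_hull (range v) = mink_sum (conv_hull (range s)) (conv_hull (range t)).
Proof.
move=> cs ct st; apply/seteqP; split.
  apply: hull_sub => [|_ [i _ <-]].
    by apply: mink_sum_convex; exact: hull_convex.
  by exists (s i); [|exists (t i)] => //; apply: sub_hull; exists i.
move=> _ [x hx [y hy <-]]; apply: separation => c.
have [i ic] := sorting c; exists i; rewrite -st !dotpDl.
by apply: lerD; apply: coherent_hull.
Qed.

Lemma indecomposable_rigid v : coherent v ->
  indecomposable (conv_hull (range v)) -> rigid v.
Proof.
move=> cv indec s t cs ct st.
have [[a [u [a0 sE]]] _] :=
  indec _ _ (coherent_polytope s) (coherent_polytope t)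
    (hull_mink_sum cs ct st).
exists a, u; split=> // i; move: sE; rewrite -hull_affine.
move/(congr1 (@vert R n)); rewrite !vert_hull // => [->//|].
exact: coherent_affine.
Qed.

Lemma polytope_convex P : polytope P -> @convex_set R 'rV[R]_n P.
Proof. by move=> [X [_ _ ->]]; exact: hull_convex. Qed.

Lemma polytope_coherent Q s : polytope Q -> (forall i, Q (s i)) ->
  (forall i c y, braid_cone i c -> Q y -> dotp y c <= dotp (s i) c) ->
  coherent s /\ Q = conv_hull (range s).
Proof.
move=> /polytope_convex cQ Qs smax; split=> [i j c ic|]; first exact: smax.
apply/seteqP; split=> [y Qy|].
  by apply: separation => c; have [i ic] := sorting c; exists i; exact: smax.
by apply: hull_sub => // _ [i _ <-].
Qed.

(** Split each vertex [v i] along the decomposition.  Each half maximizes every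
direction of the cone of [i] over its own summand, so the two halves are
coherent and span the summands, whatever polytopes these are. *)
Lemma rigid_indecomposable v : coherent v -> rigid v ->
  indecomposable (conv_hull (range v)).
Proof.
move=> cv rv Q S pQ pS PE.
have /choice[s hs] i : exists x, Q x /\ exists y, S y /\ x + y = v i.
  have : mink_sum Q S (v i) by rewrite -PE; apply: sub_hull; exists i.
  by move=> [x Qx [y Sy xy]]; exists x; split=> //; exists y.
have /choice[t ht] i : exists y, S y /\ s i + y = v i by exact: (hs i).2.
have sum_le i c x y : braid_cone i c -> Q x -> S y ->
    dotp x c + dotp y c <= dotp (s i) c + dotp (t i) c.
  move=> ic Qx Sy; rewrite -!dotpDl (ht i).2; apply: coherent_hull => //.
  by rewrite PE; exists x => //; exists y.
have [cs QE] : coherent s /\ Q = conv_hull (range s).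
  apply: polytope_coherent => // [i|i c x ic Qx]; first exact: (hs i).1.
  by have := sum_le i c x (t i) ic Qx (ht i).1; rewrite lerD2r.
have [ct SE] : coherent t /\ S = conv_hull (range t).
  apply: polytope_coherent => // [i|i c y ic Sy]; first exact: (ht i).1.
  by have := sum_le i c (s i) y ic (hs i).1 Sy; rewrite lerD2l.
split.
  have [i|a [u [a0 sE]]] := rv s t cs ct; first exact: (ht i).2.
  by exists a, u; split=> //; rewrite -hull_affine QE (funext sE).
have [i|a [u [a0 tE]]] := rv t s ct cs; first by rewrite addrC (ht i).2.
by exists a, u; split=> //; rewrite -hull_affine SE (funext tE).
Qed.

End Rigid.

(** * Inserting an element in a linear order *)

Section Orders.
Variable n : nat.
Implicit Types (r : 'S_n) (s : 'S_(n + 1)) (k : nat).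

(** The lift appends its coordinate at the end, so the old elements sit in
['I_(n + 1)] through [lshift] and the fresh one is the last. *)
Definition old (a : 'I_n) : 'I_(n + 1) := lshift 1 a.
Definition fresh : 'I_(n + 1) := rshift n ord0.

Lemma old_or_fresh (P : 'I_(n + 1) -> Prop) :
  (forall a, P (old a)) -> P fresh -> forall b, P b.
Proof.
move=> Po Pn b; case: (split_ordP b) => [a ->|a ->]; first exact: Po.
by rewrite (ord1 a); exact: Pn.
Qed.

Definition above s a := (rank s fresh < rank s (old a))%N.

Lemma above_negb s a : ~~ above s a = (rank s (old a) < rank s fresh)%N.
Proof.
rewrite /above -leqNgt leq_eqVlt; case: eqVneq => // /rank_inj /eqP.
by rewrite eq_lrshift.
Qed.

(** The order induced on the old elements. *)
Definition restr s : 'S_n := xget 1%g [set r | forall a b,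
  (rank r a <= rank r b)%N = (rank s (old a) <= rank s (old b))%N].

Lemma restrE s a b :
  (rank (restr s) a <= rank (restr s) b)%N =
  (rank s (old a) <= rank s (old b))%N.
Proof.
rewrite /restr; case: xgetP => [r _ -> //|/(_ _)].
have [r hr] := sorting_key (fun a => rank s (old a)).
move=> /(_ r) []; move=> {}a {}b /=; apply/idP/idP; first exact: hr.
apply: contraTT; rewrite -!ltnNge => ba.
have := hr _ _ (ltnW ba); rewrite leEnat leq_eqVlt.
move=> /orP[/eqP/rank_inj/lshift_inj e|//].
by rewrite e ltnn in ba.
Qed.

(** The order [r] with the fresh element put just below the old element of rank
[k]: at the bottom for [k = 0] and at the top for [k = n]. *)
Definition insert r k : 'S_(n + 1) := xget 1%g [set s |
  (forall a b, (rank s (old a) <= rank s (old b))%N =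
               (rank r a <= rank r b)%N) /\
  (forall a, above s a = (k <= rank r a)%N)].

Lemma insertP r k :
  (forall a b, (rank (insert r k) (old a) <= rank (insert r k) (old b))%N =
               (rank r a <= rank r b)%N) /\
  (forall a, above (insert r k) a = (k <= rank r a)%N).
Proof.
rewrite /insert; case: xgetP => [s _ []//|/(_ _)].
(* odd keys for the old elements leave room for the even key of the fresh one *)
pose f (b : 'I_(n + 1)) := match fintype.split b with
  | inl a => (rank r a).*2.+1 | inr _ => k.*2 end.
have fo a : f (old a) = (rank r a).*2.+1 by rewrite /f (unsplitK (inl a)).
have fn : f fresh = k.*2 by rewrite /f (unsplitK (inr ord0)).
have finj : injective f.
  apply: old_or_fresh => [a|]; apply: old_or_fresh => [b|]; rewrite ?fo ?fn //.
  - by move=> [] /double_inj /rank_inj ->.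
  - by lia.
  - by lia.
have [s hs] := sorting_key f.
have sE a b : (rank s a <= rank s b)%N = (f a <= f b)%N.
  apply/idP/idP; first exact: hs.
  apply: contraTT; rewrite -!ltnNge => ba.
  have := hs _ _ (ltnW ba); rewrite leEnat leq_eqVlt => /orP[/eqP/finj e|//].
  by rewrite e ltnn in ba.
move=> /(_ s) []; split=> [a b|a] /=; first by rewrite sE !fo ltnS leq_double.
by rewrite /above ltnNge sE fo fn -ltnNge ltnS leq_double.
Qed.

Lemma insert_old r k a b :
  (rank (insert r k) (old a) <= rank (insert r k) (old b))%N =
  (rank r a <= rank r b)%N.
Proof. exact: (insertP r k).1. Qed.

Lemma above_insert r k a : above (insert r k) a = (k <= rank r a)%N.
Proof. exact: (insertP r k).2. Qed.

Lemma restr_insert r k : restr (insert r k) = r.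
Proof. by apply: rank_le_inj => a b; rewrite restrE insert_old. Qed.

Lemma above_insert0 r a : above (insert r 0) a.
Proof. by rewrite above_insert. Qed.

Lemma above_insertn r a : above (insert r n) a = false.
Proof. by rewrite above_insert leqNgt ltn_ord. Qed.

End Orders.

(** * The vertices of the lifted GP-sum *)

Section Glue.
Variables (R : realType) (n : nat) (p q : 'S_n -> 'rV[R]_n).
Implicit Types (c x y : 'rV[R]_n) (s : 'S_(n + 1)).

Definition mix s : 'rV[R]_n :=
  \row_a (if above s a then p (restr s) else q (restr s)) ord0 a.

Definition glue s : 'rV[R]_(n + 1) := lift_point (mix s).

Lemma lift_point_old x a : lift_point x ord0 (old a) = x ord0 a.
Proof. by rewrite row_mxEl. Qed.

Lemma lift_point_fresh x : lift_point x ord0 (fresh n) = - \sum_i x ord0 i.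
Proof. by rewrite row_mxEr mxE. Qed.

Lemma sum_old_fresh (F : 'I_(n + 1) -> R) :
  \sum_i F i = \sum_a F (old a) + F (fresh n).
Proof. by rewrite big_split_ord /= big_ord1. Qed.

Lemma glue_old s a :
  glue s ord0 (old a) = (if above s a then p (restr s) else q (restr s)) ord0 a.
Proof. by rewrite lift_point_old mxE. Qed.

(** On points of zero sum, a direction acts as its normalization that vanishes
on the fresh element. *)
Definition relative (c : 'rV[R]_(n + 1)) : 'rV[R]_n :=
  \row_a (c ord0 (old a) - c ord0 (fresh n)).

Lemma dotp_lift x (c : 'rV[R]_(n + 1)) :
  dotp (lift_point x) c = dotp x (relative c).
Proof.
rewrite /dotp sum_old_fresh lift_point_fresh mulNr mulr_suml -sumrN.
rewrite -big_split /=.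
by apply: eq_bigr => a _; rewrite lift_point_old mxE; ring.
Qed.

Hypotheses (cp : coherent p) (cq : coherent q).
Hypothesis qp : forall r a, q r ord0 a <= p r ord0 a.

Let G := gp_sum (conv_hull (range q)) (conv_hull (range p)).

(** The positive part [d1] and the negative part [d2] of the normalized
direction belong to the cone of [restr s].  On [P + R_-] the form [d1] is
bounded by its value at [p], on [Q + R_+] the form [d2] by its value at [q],
and [glue] attains both bounds: [d2] vanishes above the fresh element and [d1]
below it. *)
Lemma glue_max s (c : 'rV[R]_(n + 1)) x : G x -> braid_cone s c ->
  dotp (lift_point x) c <= dotp (glue s) c.
Proof.
move=> [[y hy [z z0 xyz]] [y' hy' [z' z'0 xyz']]] /braid_coneP sc.
rewrite !dotp_lift; set d := relative c.
pose d1 : 'rV[R]_n := \row_a Num.max (d ord0 a) 0.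
pose d2 : 'rV[R]_n := \row_a Num.min (d ord0 a) 0.
have d1E a : d1 ord0 a = Num.max (d ord0 a) 0 by rewrite mxE.
have d2E a : d2 ord0 a = Num.min (d ord0 a) 0 by rewrite mxE.
have dE a : d ord0 a = d1 ord0 a + d2 ord0 a.
  by rewrite d1E d2E addr_max_min addr0.
have {}dE : d = d1 + d2 by apply/rowP => a; rewrite [RHS]mxE dE.
have dmono a b : (rank (restr s) a <= rank (restr s) b)%N ->
    d ord0 a <= d ord0 b.
  by rewrite restrE => /sc; rewrite !mxE lerD2r.
have c1 : braid_cone (restr s) d1.
  apply/braid_coneP => a b /dmono ab; rewrite !d1E.
  by rewrite ge_max !le_max lexx ab /= orbT.
have c2 : braid_cone (restr s) d2.
  apply/braid_coneP => a b /dmono ab; rewrite !d2E.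
  by rewrite le_min !ge_min lexx ab /= orbT.
have -> : dotp (mix s) d = dotp (p (restr s)) d1 + dotp (q (restr s)) d2.
  rewrite /dotp -big_split; apply: eq_bigr => a _.
  rewrite dE [X in _ * X]mxE [X in X * _]mxE d1E d2E /=.
  have da : d ord0 a = c ord0 (old a) - c ord0 (fresh n) by rewrite mxE.
  case: ifPn => [ab|]; last rewrite above_negb => ab.
    have /sc := ltnW ab; rewrite -subr_ge0 -da => h.
    by rewrite (max_idPl h) (min_idPr h) !mulr0 !addr0.
  have /sc := ltnW ab; rewrite -subr_le0 -da => h.
  by rewrite (max_idPr h) (min_idPl h) !mulr0 !add0r.
rewrite dE dotpDr; apply: lerD.
  rewrite -xyz' dotpDl -[leRHS]addr0; apply: lerD; first exact: coherent_hull.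
  apply: sumr_le0 => a _; apply: mulr_le0_ge0; first exact: z'0.
  by rewrite d1E le_max lexx orbT.
rewrite -xyz dotpDl -[leRHS]addr0; apply: lerD; first exact: coherent_hull.
apply: sumr_le0 => a _; apply: mulr_ge0_le0; first exact: z0.
by rewrite d2E ge_min lexx orbT.
Qed.

Lemma mix_gp_sum s : G (mix s).
Proof.
split.
  exists (q (restr s)); first by apply: sub_hull; exists (restr s).
  exists (mix s - q (restr s)); last by rewrite addrC subrK.
  by move=> a; rewrite !mxE subr_ge0; case: ifP.
exists (p (restr s)); first by apply: sub_hull; exists (restr s).
exists (mix s - p (restr s)); last by rewrite addrC subrK.
by move=> a; rewrite !mxE subr_le0; case: ifP.
Qed.

Lemma coherent_glue : coherent glue.
Proof. by move=> s t c; apply: glue_max; exact: mix_gp_sum. Qed.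

Lemma gp_sum_convex (A B : set 'rV[R]_n) :
  @convex_set R 'rV[R]_n A -> @convex_set R 'rV[R]_n B ->
  @convex_set R 'rV[R]_n (gp_sum A B).
Proof.
move=> cA cB; have c1 : @convex_set R 'rV[R]_n (@nonneg_orthant R n).
  apply/convex_setP => x y k k0 k1 hx hy a; rewrite !mxE.
  by have := hx a; have := hy a; nra.
have c2 : @convex_set R 'rV[R]_n (@nonpos_orthant R n).
  apply/convex_setP => x y k k0 k1 hx hy a; rewrite !mxE.
  by have := hx a; have := hy a; nra.
apply/convex_setP => x y k k0 k1 [hx1 hx2] [hy1 hy2]; split.
  by move/convex_setP: (mink_sum_convex cA c1); apply.
by move/convex_setP: (mink_sum_convex cB c2); apply.
Qed.

Lemma lift_gp_sum :
  lift_set (gp_sum (conv_hull (range q)) (conv_hull (range p))) =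
  conv_hull (range glue).
Proof.
apply/seteqP; split.
  move=> _ [x Gx <-]; apply: separation => c; have [s sc] := sorting c.
  by exists s; exact: glue_max.
apply: hull_sub => [|_ [s _ <-]]; last first.
  by exists (mix s) => //; exact: mix_gp_sum.
apply/convex_setP => _ _ k k0 k1 [x Gx <-] [y Gy <-].
exists (k *: x + (1 - k) *: y).
  move/convex_setP: (gp_sum_convex (@hull_convex R n (range q))
    (@hull_convex R n (range p))); exact.
apply/rowP; apply: old_or_fresh => [a|].
  rewrite [RHS]mxE [X in _ = X + _]mxE [X in _ = _ + X]mxE.
  by rewrite !lift_point_old !mxE.
rewrite [RHS]mxE [X in _ = X + _]mxE [X in _ = _ + X]mxE !lift_point_fresh.
rewrite !mulrN !mulr_sumr -opprD -big_split /=; congr (- _).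
by apply: eq_bigr => a _; rewrite !mxE.
Qed.

End Glue.

(** * Rigidity of the glued family *)

Section CoherentPlusOne.
Variables (R : realType) (n : nat).
Implicit Types (w : 'S_(n + 1) -> 'rV[R]_(n + 1)).

Lemma coherent_eq m (v : 'S_m -> 'rV[R]_m) s t c : coherent v ->
  braid_cone s c -> braid_cone t c -> dotp (v s) c = dotp (v t) c.
Proof. by move=> cv sc tc; apply/eqP; rewrite eq_le !cv. Qed.

Lemma coherent_total m (v : 'S_m -> 'rV[R]_m) s t : coherent v ->
  \sum_i v s ord0 i = \sum_i v t ord0 i.
Proof.
move=> cv; pose c : 'rV[R]_m := const_mx 1.
have cc (r : 'S_m) : braid_cone r c by move=> i j _; rewrite !mxE.
have := coherent_eq cv (cc s) (cc t).
by rewrite /dotp; under eq_bigr do rewrite mxE mulr1;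
  under [RHS]eq_bigr do rewrite mxE mulr1.
Qed.

(** Upper sets of an order are the ones at which its vertex attains the support
function, which is what the greedy formula needs. *)
Lemma upper_indicator m (s : 'S_m) a :
  braid_cone s (\row_b (rank s a <= rank s b)%:R : 'rV[R]_m).
Proof.
apply/braid_coneP => b b' bb; rewrite !mxE ler_nat.
by have [/leq_trans -> //|] := leqP (rank s a) (rank s b).
Qed.

Lemma strict_upper_indicator m (s : 'S_m) a :
  braid_cone s (\row_b (rank s a < rank s b)%:R : 'rV[R]_m).
Proof.
apply/braid_coneP => b b' bb; rewrite !mxE ler_nat.
by have [/leq_trans -> //|] := ltnP (rank s a) (rank s b).
Qed.

(** The greedy formula: the coordinate at [a] is the difference of the values of
the support function at the upper set from [a] on and at the one strictly
above [a].  Both values are attained by every order in which these sets are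
upper sets. *)
Lemma coherent_local m (v : 'S_m -> 'rV[R]_m) s t a : coherent v ->
  (forall b, (rank s a <= rank s b)%N = (rank t a <= rank t b)%N) ->
  v s ord0 a = v t ord0 a.
Proof.
move=> cv st.
pose c (r : 'S_m) : 'rV[R]_m := \row_b (rank r a <= rank r b)%:R.
pose d (r : 'S_m) : 'rV[R]_m := \row_b (rank r a < rank r b)%:R.
have c_cone r : braid_cone r (c r) by exact: upper_indicator.
have d_cone r : braid_cone r (d r) by exact: strict_upper_indicator.
have ec : c s = c t by apply/rowP => b; rewrite !mxE st.
have lt r b : (rank r a < rank r b)%N = (a != b) && (rank r a <= rank r b)%N.
  by rewrite ltn_neqAle (inj_eq (@rank_inj _ r)).
have ed : d s = d t by apply/rowP => b; rewrite !mxE !lt st.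
have cd r : c r - d r = e_ R a.
  apply/rowP => b; rewrite !mxE lt eqxx /= eq_sym.
  by case: eqVneq => [->|_] /=; rewrite ?leqnn ?subr0 ?subrr.
have := coherent_eq cv (c_cone s) (eq_ind_r (braid_cone t) (c_cone t) ec).
have := coherent_eq cv (d_cone s) (eq_ind_r (braid_cone t) (d_cone t) ed).
by move=> hd hc; rewrite -!dotp_e -(cd s) !dotpBr hd hc.
Qed.

Lemma coherent_above w s a : coherent w -> above s a ->
  w s ord0 (old a) = w (insert (restr s) 0) ord0 (old a).
Proof.
move=> cw sa; apply: coherent_local => //.
apply: old_or_fresh => [b|]; first by rewrite insert_old restrE.
by rewrite [LHS]leqNgt [RHS]leqNgt -!/(above _ _) sa above_insert0.
Qed.

Lemma coherent_below w s a : coherent w -> ~~ above s a ->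
  w s ord0 (old a) = w (insert (restr s) n) ord0 (old a).
Proof.
move=> cw sa; apply: coherent_local => //.
apply: old_or_fresh => [b|]; first by rewrite insert_old restrE.
by rewrite [LHS]leqNgt [RHS]leqNgt -!/(above _ _) sa above_insertn.
Qed.

(** Submodularity.  Compare the orders that put the fresh element just below and
just above [a]: their vertices agree at the other old coordinates, and the
upper set that starts at [a] in the first order avoids the fresh element. *)
Lemma coherent_monotone w r a : coherent w ->
  w (insert r n) ord0 (old a) <= w (insert r 0) ord0 (old a).
Proof.
move=> cw; pose s := insert r (rank r a); pose t := insert r (rank r a).+1.
have sa : above s a by rewrite above_insert.
have ta : ~~ above t a by rewrite above_insert ltnn.
have := coherent_above cw sa; have := coherent_below cw ta.
rewrite !restr_insert => <- <-.
have eq_off b : b != a -> w s ord0 (old b) = w t ord0 (old b).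
  move=> ba; have st : above s b = above t b.
    by rewrite !above_insert [RHS]ltn_neqAle (inj_eq (@rank_inj _ r)) eq_sym ba.
  have [sb|sb] := boolP (above s b).
    have tb : above t b by rewrite -st.
    by rewrite (coherent_above cw sb) (coherent_above cw tb) !restr_insert.
  have tb : ~~ above t b by rewrite -st.
  by rewrite (coherent_below cw sb) (coherent_below cw tb) !restr_insert.
pose c : 'rV[R]_(n + 1) := \row_b (rank s (old a) <= rank s b)%:R.
have sc : braid_cone s c by exact: upper_indicator.
have := cw s t c sc; rewrite /dotp !sum_old_fresh.
have -> : c ord0 (fresh n) = 0 by rewrite mxE leqNgt -/(above s a) sa.
rewrite !mulr0 !addr0 (bigD1 a) //= [leRHS](bigD1 a) //=.
have -> : c ord0 (old a) = 1 by rewrite mxE leqnn.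
rewrite !mulr1 (eq_bigr (fun b => w s ord0 (old b) * c ord0 (old b))).
  by rewrite lerD2r.
by move=> b ba; rewrite eq_off.
Qed.

(** When the fresh element stays at one end of the orders, a direction on the
old coordinates extends by an extreme value on the fresh one.  This extension
tests the old coordinates alone because the fresh coordinate is then the same
for all orders, its unit vector being up to sign in all the cones. *)
Lemma coherent_extreme w (f : 'S_n -> 'S_(n + 1)) (e : bool) : coherent w ->
  (forall r a b, (rank (f r) (old a) <= rank (f r) (old b))%N =
                 (rank r a <= rank r b)%N) ->
  (forall r a, above (f r) a = e) ->
  coherent (fun r => lsubmx (w (f r))).
Proof.
move=> cw f_old f_above.
have cone r (c : 'rV[R]_n) (m : R) : braid_cone r c ->
    (forall a, if e then m <= c ord0 a else c ord0 a <= m) ->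
    braid_cone (f r) (row_mx c (const_mx m)).
  move=> /braid_coneP rc hm; apply/braid_coneP.
  apply: old_or_fresh => [a|]; apply: old_or_fresh => [b|];
    rewrite ?row_mxEl ?row_mxEr ?mxE //.
  - by rewrite f_old => /rc.
  - move=> h; have := f_above r a; rewrite /above ltnNge h /= => e0.
    by have := hm a; rewrite -e0.
  - move=> h; have := above_negb (f r) b; rewrite ltnNge h f_above => e0.
    by have := hm b; case: (e) e0.
have dot x (c : 'rV[R]_n) m : dotp x (row_mx c (const_mx m)) =
    dotp (lsubmx x) c + x ord0 (fresh n) * m.
  rewrite /dotp sum_old_fresh row_mxEr mxE; congr (_ + _).
  by apply: eq_bigr => a _; rewrite row_mxEl mxE.
have fresh_const r t : w (f r) ord0 (fresh n) = w (f t) ord0 (fresh n).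
  pose z : R := if e then - 1 else 1.
  have z0 : z != 0 by rewrite /z; case: (e); rewrite ?oppr_eq0 oner_eq0.
  have hz u : braid_cone (f u) (row_mx 0 (const_mx z)).
    apply: cone => [a b _|a]; rewrite !mxE // /z.
    by case: (e); rewrite ?lerN10 ?ler01.
  have := coherent_eq cw (hz r) (hz t).
  by rewrite !dot !dotp0r !add0r => /(mulIf z0).
move=> r t c rc.
pose B := \sum_a `|c ord0 a|; pose m := if e then - B else B.
have leB a : `|c ord0 a| <= B.
  by rewrite /B (bigD1 a) //= lerDl sumr_ge0.
have hm : braid_cone (f r) (row_mx c (const_mx m)).
  apply: cone => // a; have := leB a; rewrite ler_norml /m => /andP[].
  by case: (e).
by have := cw _ (f t) _ hm; rewrite !dot (fresh_const t r) lerD2r.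
Qed.

Lemma coherent_insert0 w : coherent w ->
  coherent (fun r => lsubmx (w (insert r 0))).
Proof.
move=> cw; apply: (coherent_extreme (e := true) cw) => r a.
  exact: insert_old.
exact: above_insert0.
Qed.

Lemma coherent_insertn w : coherent w ->
  coherent (fun r => lsubmx (w (insert r n))).
Proof.
move=> cw; apply: (coherent_extreme (e := false) cw) => r a.
  exact: insert_old.
exact: above_insertn.
Qed.

Variables p q : 'S_n -> 'rV[R]_n.
Hypotheses (rp : rigid p) (rq : rigid q).
Hypothesis qp_tight : forall a, exists r, q r ord0 a = p r ord0 a.
Hypothesis qp_seed : exists j r t, [/\ q r ord0 j = p r ord0 j,
  q t ord0 j = p t ord0 j & p r ord0 j != p t ord0 j].

Lemma glue_insert0 r : lsubmx (glue p q (insert r 0)) = p r.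
Proof.
by apply/rowP => a; rewrite mxE glue_old above_insert0 restr_insert.
Qed.

Lemma glue_insertn r : lsubmx (glue p q (insert r n)) = q r.
Proof.
by apply/rowP => a; rewrite mxE glue_old above_insertn restr_insert.
Qed.

(** A summand [s] is an affine copy of [p] when the fresh element is at the
bottom and of [q] when it is at the top; the equalities between [q] and [p]
identify these two affine maps, and [coherent_local] spreads the common one to
all positions of the fresh element. *)
Lemma rigid_glue : rigid (glue p q).
Proof.
move=> s t cs ct st.
have st_sub i : lsubmx (s i) + lsubmx (t i) = lsubmx (glue p q i).
  by rewrite -st; apply/rowP => a; rewrite !mxE.
have [r|a [u [a0 sp]]] := rp (coherent_insert0 cs) (coherent_insert0 ct).
  by rewrite st_sub glue_insert0.
have [r|b [u' [_ sq]]] := rq (coherent_insertn cs) (coherent_insertn ct).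
  by rewrite st_sub glue_insertn.
(* both summands are monotone, and their gaps add up to that of p and q *)
have tight r i : q r ord0 i = p r ord0 i ->
    a * p r ord0 i + u ord0 i = b * p r ord0 i + u' ord0 i.
  move=> e; have := coherent_monotone r i cs; have := coherent_monotone r i ct.
  have := congr1 (fun x : 'rV_n => x ord0 i) (sp r).
  have := congr1 (fun x : 'rV_n => x ord0 i) (sq r).
  have := congr1 (fun x : 'rV_n => x ord0 i) (st_sub (insert r 0)).
  have := congr1 (fun x : 'rV_n => x ord0 i) (st_sub (insert r n)).
  by rewrite glue_insert0 glue_insertn !mxE -!/(old _) e; lra.
have ab : a = b.
  have [j [r [r' [e e' ne]]]] := qp_seed.
  have := tight _ _ e; have := tight _ _ e' => h' h.
  have : (a - b) * (p r ord0 j - p r' ord0 j) = 0 by lra.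
  by move/eqP; rewrite mulf_eq0 !subr_eq0 (negPf ne) orbF => /eqP.
have uu : u = u'.
  apply/rowP => i; have [r e] := qp_tight i.
  by have := tight _ _ e; rewrite ab => /addrI.
have s_old i x : s i ord0 (old x) = a * mix p q i ord0 x + u ord0 x.
  rewrite [mix _ _ _ _ _]mxE; case: ifPn => ix.
    rewrite (coherent_above cs ix).
    have := congr1 (fun x0 : 'rV_n => x0 ord0 x) (sp (restr i)).
    by rewrite !mxE.
  rewrite (coherent_below cs ix).
  have := congr1 (fun x0 : 'rV_n => x0 ord0 x) (sq (restr i)).
  by rewrite !mxE ab uu.
pose K := \sum_i s 1%g ord0 i.
exists a, (row_mx u (const_mx (K - \sum_i u ord0 i))); split=> // i.
apply/rowP; apply: old_or_fresh => [x|].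
  by rewrite s_old [RHS]mxE [X in _ = X + _]mxE lift_point_old row_mxEl.
rewrite [RHS]mxE [X in _ = X + _]mxE lift_point_fresh row_mxEr mxE.
have := coherent_total i 1%g cs; rewrite -/K sum_old_fresh.
under eq_bigr do rewrite s_old.
rewrite big_split /= -mulr_sumr; lra.
Qed.

End CoherentPlusOne.

(** * Seeds and fertility *)

Section Seeds.
Variables (R : realType) (n : nat).
Implicit Types (P Q : set 'rV[R]_n) (lam mu : R).

(** In the plane of the points [(P^s_j, Q^s_j)], a point that is both leftmost
and highest is the only minimizer of [lam * x - mu * y] for positive [lam] and
[mu].  If there is none, start from the highest of the leftmost points: the
steepest segment from it to a higher point is an edge of positive slope. *)
Lemma fertileP P Q : fertile P Q <-> exists j, ~ exists s, forall t,
  vert P s ord0 j <= vert P t ord0 j /\ vert Q t ord0 j <= vert Q s ord0 j.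
Proof.
split.
  move=> [[lam mu] [/= lam0 mu0 [j [t [t' [ht ht' neq]]]]]]; exists j.
  move=> [s hs]; apply: neq.
  have both r : minimizers (vert_diff P Q lam mu j) r ->
      (vert P r ord0 j, vert Q r ord0 j) = (vert P s ord0 j, vert Q s ord0 j).
    move=> /(_ s); rewrite /vert_diff => le; have [hP hQ] := hs r.
    congr pair; nra.
  by rewrite (both t) ?(both t').
move=> [j no].
have s1 : 1%g \in enum {: 'S_n} by rewrite mem_enum.
(* the leftmost points, and among them the highest *)
have [sP _ minP] := seq_argmax (fun s : 'S_n => - vert P s ord0 j) s1.
have sPL : sP \in [seq s <- enum {: 'S_n} |
    vert P s ord0 j == vert P sP ord0 j].
  by rewrite mem_filter eqxx mem_enum.
have [s0] := seq_argmax (fun s : 'S_n => vert Q s ord0 j) sPL.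
rewrite mem_filter => /andP[/eqP s0P _] s0max.
have s0min t : vert P s0 ord0 j <= vert P t ord0 j.
  by rewrite s0P -lerN2 minP // mem_enum.
have [t1 ht1] : exists t, vert Q s0 ord0 j < vert Q t ord0 j.
  apply: contrapT => h; apply: no; exists s0 => t; split=> //.
  by rewrite leNgt; apply/negP => lt; apply: h; exists t.
have higher t : vert Q s0 ord0 j < vert Q t ord0 j ->
    vert P s0 ord0 j < vert P t ord0 j.
  move=> lt; rewrite lt_neqAle s0min andbT; apply: contraTneq lt => e.
  by rewrite -leNgt s0max // mem_filter -e s0P eqxx mem_enum.
pose slope t := (vert Q t ord0 j - vert Q s0 ord0 j) /
                (vert P t ord0 j - vert P s0 ord0 j).
have t1L : t1 \in [seq t <- enum {: 'S_n} | vert Q s0 ord0 j < vert Q t ord0 j].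
  by rewrite mem_filter ht1 mem_enum.
have [t] := seq_argmax slope t1L.
rewrite mem_filter => /andP[ht _] tmax.
have lam0 : 0 < slope t by rewrite divr_gt0 // subr_gt0 ?higher.
have s0m : minimizers (vert_diff P Q (slope t) 1 j) s0.
  move=> r; rewrite /vert_diff !mul1r.
  have [lt|le] := ltP (vert Q s0 ord0 j) (vert Q r ord0 j).
    have := tmax r; rewrite mem_filter lt mem_enum => /(_ isT).
    by rewrite ler_pdivrMr ?subr_gt0 ?higher //; lra.
  have := s0min r; nra.
exists (slope t, 1); split=> //=; exists j, s0, t; split=> //.
  move=> r; apply: le_trans (s0m r); rewrite /vert_diff !mul1r.
  have : slope t * (vert P t ord0 j - vert P s0 ord0 j) =
         vert Q t ord0 j - vert Q s0 ord0 j.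
    by rewrite divfK // gt_eqF // subr_gt0 higher.
  lra.
by move=> [_ e]; rewrite e ltxx in ht.
Qed.

Lemma seed_rescale P Q lam mu :
  seed_set P Q (lam, mu) -> seed_set P Q (lam / mu, 1).
Proof.
move=> [/= lam0 mu0 [j [t [t' [ht ht' neq]]]]]; split=> //=.
  by rewrite divr_gt0.
have E s : vert_diff P Q lam mu j s = mu * vert_diff P Q (lam / mu) 1 j s.
  by rewrite /vert_diff; field; rewrite gt_eqF.
have M s : minimizers (vert_diff P Q lam mu j) s ->
    minimizers (vert_diff P Q (lam / mu) 1 j) s.
  by move=> h r; have := h r; rewrite !E ler_pM2l.
by exists j, t, t'; split=> //; exact: M.
Qed.

Lemma least_finite (A : set R) : finite_set A -> A !=set0 -> A (least A).
Proof.
move=> /finite_seqP[L AL] [x0 Ax0].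
have x0L : x0 \in L by move: Ax0; rewrite AL.
have [m mL hm] := seq_argmax (fun x : R => - x) x0L.
suff [] : (A `&` lbound A) (least A) by [].
apply: xgetPex; exists m; split; first by rewrite AL.
by move=> y; rewrite AL => /hm; rewrite lerN2.
Qed.

(** The minimum exists because a seed [(lam, 1)] is the slope of a segment
between two of the finitely many points [(P^s_j, Q^s_j)]. *)
Lemma min_seedP P Q : fertile P Q -> seed_set P Q (min_seed P Q, 1).
Proof.
move=> [[lam mu] /seed_rescale h].
apply: (@least_finite [set l | seed_set P Q (l, 1)]); last by exists (lam / mu).
pose F (x : 'I_n * 'S_n * 'S_n) : R :=
  (vert Q x.1.2 ord0 x.1.1 - vert Q x.2 ord0 x.1.1) /
  (vert P x.1.2 ord0 x.1.1 - vert P x.2 ord0 x.1.1).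
apply: (@sub_finite_set _ _ (range F)); last exact/finite_image/finite_finset.
move=> l [/= l0 _ [j [t [t' [ht ht' neq]]]]]; exists (j, t, t') => //.
have := ht t'; have := ht' t; rewrite /vert_diff !mul1r => h1 h2.
have E : vert Q t ord0 j - vert Q t' ord0 j =
         l * (vert P t ord0 j - vert P t' ord0 j) by lra.
rewrite /F /= E mulfK // subr_eq0; apply/eqP => e; apply: neq; congr pair => //.
by move: E; rewrite e subrr mulr0; lra.
Qed.

Lemma phi_le P Q lam mu i s : phi P Q lam mu ord0 i <= vert_diff P Q lam mu i s.
Proof. by rewrite mxE bigmin_le. Qed.

Lemma phi_attained P Q lam mu i :
  exists s, phi P Q lam mu ord0 i = vert_diff P Q lam mu i s.
Proof.
suff [s hs] : exists s, vert_diff P Q lam mu i s <= phi P Q lam mu ord0 i.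
  by exists s; apply/eqP; rewrite eq_le phi_le.
rewrite mxE; case/bigmin_leP: (lexx (\big[Num.min/vert_diff P Q lam mu i 1%g]_s
  vert_diff P Q lam mu i s)) => [h|[s _ h]]; first by exists 1%g.
by exists s.
Qed.

End Seeds.

(** * Offspring *)

Section Offspring.
Variables (R : realType) (n : nat).
Implicit Types (P Q : set 'rV[R]_n).

(** The vertices of [lam P] and of [Q + phi], which the glued family takes when
the fresh element is at the bottom, respectively at the top, of the order. *)
Definition top_family P Q (s : 'S_n) : 'rV[R]_n := min_seed P Q *: vert P s.
Definition bottom_family P Q (s : 'S_n) : 'rV[R]_n :=
  vert Q s + phi P Q (min_seed P Q) 1.

Lemma top_family_affine P Q :
  top_family P Q = fun s => min_seed P Q *: vert P s + 0.
Proof. by apply/funext => s; rewrite addr0. Qed.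

Lemma bottom_family_affine P Q :
  bottom_family P Q = fun s => 1 *: vert Q s + phi P Q (min_seed P Q) 1.
Proof. by apply/funext => s; rewrite scale1r. Qed.

Lemma top_bottom_gap P Q s i :
  top_family P Q s ord0 i - bottom_family P Q s ord0 i =
  vert_diff P Q (min_seed P Q) 1 i s - phi P Q (min_seed P Q) 1 ord0 i.
Proof.
rewrite /vert_diff [top_family _ _ _ _ _]mxE [bottom_family _ _ _ _ _]mxE.
ring.
Qed.

Lemma bottom_le_top P Q s i :
  bottom_family P Q s ord0 i <= top_family P Q s ord0 i.
Proof. by rewrite -subr_ge0 top_bottom_gap subr_ge0 phi_le. Qed.

Lemma bottom_top_tight P Q i :
  exists s, bottom_family P Q s ord0 i = top_family P Q s ord0 i.
Proof.
have [s hs] := phi_attained P Q (min_seed P Q) 1 i; exists s.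
by apply/esym/eqP; rewrite -subr_eq0 top_bottom_gap hs subrr.
Qed.

Lemma minimizers_phi P Q lam mu i s :
  minimizers (vert_diff P Q lam mu i) s ->
  vert_diff P Q lam mu i s = phi P Q lam mu ord0 i.
Proof.
move=> h; have [t ht] := phi_attained P Q lam mu i.
by apply/eqP; rewrite eq_le phi_le ht h.
Qed.

(** This is what the seed property provides: two minimizers of coordinate [j]
are two equalities between the families, with values that differ because
equal values would give equal coordinates in [P] and in [Q]. *)
Lemma bottom_top_seed P Q : fertile P Q -> exists j r t,
  [/\ bottom_family P Q r ord0 j = top_family P Q r ord0 j,
      bottom_family P Q t ord0 j = top_family P Q t ord0 j &
      top_family P Q r ord0 j != top_family P Q t ord0 j].
Proof.
move=> /min_seedP [/= lam0 _ [j [r [t [hr ht neq]]]]]; exists j, r, t.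
have E s : minimizers (vert_diff P Q (min_seed P Q) 1 j) s ->
    bottom_family P Q s ord0 j = top_family P Q s ord0 j.
  move=> /minimizers_phi h; apply/esym/eqP.
  by rewrite -subr_eq0 top_bottom_gap h subrr.
have [Er Et] := (E r hr, E t ht); split=> //.
apply/eqP => e; apply: neq; congr pair.
  by move: e; rewrite !mxE => /(mulfI (lt0r_neq0 lam0)).
by move: e; rewrite -Er -Et !mxE => /addIr.
Qed.

Lemma offspring_glue P Q :
  P = conv_hull (range (vert P)) -> Q = conv_hull (range (vert Q)) ->
  offspring P Q = lift_set (gp_sum (conv_hull (range (bottom_family P Q)))
                                   (conv_hull (range (top_family P Q)))).
Proof.
move=> EP EQ; rewrite /offspring top_family_affine bottom_family_affine.
rewrite !hull_affine -EP -EQ.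
congr (lift_set (gp_sum (translate _ _) _)).
  by apply/seteqP; split=> [x Qx|_ [x Qx <-]]; [exists x|]; rewrite ?scale1r.
by apply/seteqP; split=> [x Px|_ [x Px <-]]; [exists x|]; rewrite ?addr0.
Qed.

Section Family.
Variables P Q : set 'rV[R]_n.
Hypotheses (hP : indec_deformed_permutahedron P).
Hypotheses (hQ : indec_deformed_permutahedron Q).
Hypothesis PQ : fertile P Q.

Let cvP : coherent (vert P). Proof. by have [/deformed_coherent[]] := hP. Qed.
Let cvQ : coherent (vert Q). Proof. by have [/deformed_coherent[]] := hQ. Qed.
Let EP : P = conv_hull (range (vert P)).
Proof. by have [/deformed_coherent[]] := hP. Qed.
Let EQ : Q = conv_hull (range (vert Q)).
Proof. by have [/deformed_coherent[]] := hQ. Qed.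

Lemma min_seed_gt0 : 0 < min_seed P Q.
Proof. by have [] := min_seedP PQ. Qed.

Lemma coherent_top : coherent (top_family P Q).
Proof.
by rewrite top_family_affine; exact: coherent_affine (ltW min_seed_gt0) cvP.
Qed.

Lemma coherent_bottom : coherent (bottom_family P Q).
Proof. by rewrite bottom_family_affine; exact: coherent_affine ler01 cvQ. Qed.

Lemma rigid_top : rigid (top_family P Q).
Proof.
rewrite top_family_affine; apply: (@rigid_affine R n _ 0 (vert P)).
  exact: min_seed_gt0.
by apply: (indecomposable_rigid cvP); rewrite -EP; have [] := hP.
Qed.

Lemma rigid_bottom : rigid (bottom_family P Q).
Proof.
rewrite bottom_family_affine; apply: (@rigid_affine R n 1 _ (vert Q)).
  exact: ltr01.
by apply: (indecomposable_rigid cvQ); rewrite -EQ; have [] := hQ.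
Qed.

Lemma coherent_offspring : coherent (glue (top_family P Q) (bottom_family P Q)).
Proof.
apply: (coherent_glue coherent_top coherent_bottom); exact: bottom_le_top.
Qed.

Lemma offspring_hull :
  offspring P Q = conv_hull (range (glue (top_family P Q) (bottom_family P Q))).
Proof.
rewrite offspring_glue // lift_gp_sum //; first exact: coherent_top.
  exact: coherent_bottom.
exact: bottom_le_top.
Qed.

Lemma vert_offspring :
  vert (offspring P Q) = glue (top_family P Q) (bottom_family P Q).
Proof. by rewrite offspring_hull (vert_hull coherent_offspring). Qed.

Lemma offspring_indec : indec_deformed_permutahedron (offspring P Q).
Proof.
rewrite offspring_hull; split.
- exact/coherent_deformed/coherent_offspring.
- apply: (rigid_indecomposable coherent_offspring).
  apply: (rigid_glue rigid_top rigid_bottom).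
  + exact: bottom_top_tight.
  + exact: bottom_top_seed.
- move=> [x Ex]; have [j [r [t [_ _]]]] := bottom_top_seed PQ.
  apply/negP; rewrite negbK.
  have E s : glue (top_family P Q) (bottom_family P Q) s = x.
    have : [set x] (glue (top_family P Q) (bottom_family P Q) s).
      by rewrite -Ex; apply: sub_hull; exists s.
    by [].
  rewrite -(glue_insert0 (top_family P Q) (bottom_family P Q) r) E.
  rewrite -(E (insert t 0)).
  by rewrite glue_insert0.
Qed.

End Family.

(** In coordinate [j], being minimal for the first offspring and maximal for the
second passes to [Q] and [P'] at the restricted order, on whichever side of
the fresh element [j] lies. *)
Lemma offspring_fertile P Q P' Q' :
  indec_deformed_permutahedron P -> indec_deformed_permutahedron Q ->
  indec_deformed_permutahedron P' -> indec_deformed_permutahedron Q' ->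
  fertile P Q -> fertile P' Q' -> fertile Q P' ->
  fertile (offspring P Q) (offspring P' Q').
Proof.
move=> hP hQ hP' hQ' PQ PQ' /fertileP[j no]; apply/fertileP; exists (old j).
rewrite (vert_offspring hP hQ PQ) (vert_offspring hP' hQ' PQ').
move=> -[s hs]; apply: no; exists (restr s) => t; split.
  have [h _] := hs (insert t n); move: h.
  rewrite [leLHS]glue_old [leRHS]glue_old above_insertn restr_insert => h.
  suff : bottom_family P Q (restr s) ord0 j <= bottom_family P Q t ord0 j.
    by rewrite !mxE lerD2r.
  by apply: le_trans h; case: ifP => // _; exact: bottom_le_top.
have [_ h] := hs (insert t 0); move: h.
rewrite [leLHS]glue_old [leRHS]glue_old above_insert0 restr_insert => h.
suff : top_family P' Q' t ord0 j <= top_family P' Q' (restr s) ord0 j.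
  by rewrite !mxE ler_pM2l // min_seed_gt0.
by apply: le_trans h _; case: ifP => // _; exact: bottom_le_top.
Qed.

End Offspring.

Theorem theorem1 (R : realType) (n r : nat) (P : 'I_r -> set 'rV[R]_n)
    (n_ge1 : (1 <= n)%N)
    (P_indec : forall i, indec_deformed_permutahedron (P i))
    (P_fertile : forall i j, fertile (P i) (P j)) :
  (forall i j, indec_deformed_permutahedron (offspring (P i) (P j))) /\
  (forall i j k l,
     fertile (offspring (P i) (P j)) (offspring (P k) (P l))).
Proof.
by split=> [i j|i j k l]; [exact: offspring_indec|exact: offspring_fertile].
Qed.
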